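(* Suppose the law $\mathbb{P}_{\boldsymbol{w}}$ of the disturbance is log-concave and $\mathcal{O}(\overline{0})$ is convex and compact. Then for every $\alpha>0$ and every $\tau\in\{1,\dots,N\}$, the $\alpha$-probabilistic occupied set $\mathrm{PrOccupySet}_S(\alpha;\tau)$ of the rigid body obstacle with DMSP dynamics is covered by a finite union of convex and compact sets: $$\mathrm{PrOccupySet}_S(\alpha;\tau)\subseteq\bigcup_{\overline{q}_\tau\in\mathcal{G}_{\mathcal{Q}^\tau}}\mathrm{PrOccupySet}_P\big(\alpha_S(\overline{q}_\tau);\tau,\overline{q}_{\tau-1}\big),\qquad \alpha_S(\overline{q}_\tau)=\frac{\alpha}{|\mathcal{G}_{\mathcal{Q}^\tau}|\ \mathbb{P}\{\overline{\boldsymbol{\sigma}}_\tau=\overline{q}_\tau\}},$$ each set on the right-hand side being convex and compact.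
   Context: DMSP system (discrete-time Markovian switched system with affine parameter-varying stochastic subsystems). Let $N\ge1$, let $\mathcal{Q}\subset\mathbb{R}$ and $\mathcal{P}\subset\mathbb{R}^l$ be finite, and let $A:\mathcal{P}\to\mathbb{R}^{n\times n}$, $B:\mathcal{P}\to\mathbb{R}^{n\times m}$, $F:\mathcal{P}\to\mathbb{R}^{n\times p}$. For $t=0,\dots,N-1$: (i) the discrete state $\boldsymbol{\sigma}_t\in\mathcal{Q}$ is a (possibly time-inhomogeneous) Markov chain with $\boldsymbol{\sigma}_0=q_0$; (ii) $\boldsymbol{\lambda}_{t+1}=l_\lambda(\boldsymbol{\sigma}_{t+1},t,\boldsymbol{\lambda}_t)\in\mathcal{P}$, $\boldsymbol{\lambda}_0=\overline{\lambda}_0$, for a given Borel function $l_\lambda:\mathcal{Q}\times\{0,\dots,N-1\}\times\mathcal{P}\to\mathcal{P}$; (iii) $\boldsymbol{x}_{t+1}=A(\boldsymbol{\lambda}_t)\boldsymbol{x}_t+B(\boldsymbol{\lambda}_t)\overline{u}_t+F(\boldsymbol{\lambda}_t)\boldsymbol{w}_t\in\mathbb{R}^n$, $\boldsymbol{x}_0=\overline{x}_0$. The $q_0,\overline\lambda_0,\overline{x}_0$ and inputs $\overline{u}_t\in\mathbb{R}^m$ are known and deterministic; $\boldsymbol{w}_0,\dots,\boldsymbol{w}_{N-1}$ are IID random vectors in $\mathbb{R}^p$ with law $\mathbb{P}_{\boldsymbol{w}}$ having a density, independent of the discrete state process. Obstacle: $h_{\mathrm{obs}}:\mathbb{R}^n\to\mathbb{R}$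 is Borel and $\mathcal{O}(\overline{c})=\{\overline{z}:h_{\mathrm{obs}}(\overline{z}-\overline{c})\ge0\}$; $\mathcal{O}(\overline{0})$ is a Borel set of non-zero Lebesgue measure. $-\mathcal{G}=\{\overline z:-\overline z\in\mathcal{G}\}$. DMSP occupancy: with $\boldsymbol{s}_\tau=(\boldsymbol{\sigma}_\tau,\boldsymbol{x}_\tau)$, $\phi_{\boldsymbol{s}}(\overline{y};\tau)=\mathbb{P}\{\boldsymbol{s}_\tau\in\bigcup_{q\in\mathcal{Q}}\{q\}\times(-\mathcal{O}(-\overline{y}))\}$ and $\mathrm{PrOccupySet}_S(\alpha;\tau)=\{\overline{y}\in\mathbb{R}^n:\phi_{\boldsymbol{s}}(\overline{y};\tau)\ge\alpha\}$. Notation: $\overline{\boldsymbol{\sigma}}_\tau=(\boldsymbol{\sigma}_1,\dots,\boldsymbol{\sigma}_\tau)$, $\overline{q}_\tau=(q_1,\dots,q_\tau)$, $\overline{q}_{\tau-1}=(q_1,\dots,q_{\tau-1})$, and $\mathcal{G}_{\mathcal{Q}^\tau}=\{\overline{q}_\tau\in\mathcal{Q}^\tau:\mathbb{P}\{\overline{\boldsymbol{\sigma}}_\tau=\overline{q}_\tau\}>0\}$. $\mathrm{PrOccupySet}_P(\beta;\tau,\overline{q}_{\tau-1})=\{\overline{y}\in\mathbb{R}^n:\mathbb{P}\{\boldsymbol{x}^{\overline q}_\tau\in-\mathcal{O}(-\overline{y})\}\ge\beta\}$, where $\boldsymbol{x}^{\overline q}_\tau$ is the state at time $\tau$ of $\boldsymbol{x}_{t+1}=A(\overline\lambda_t)\boldsymbol{x}_t+B(\overline\lambda_t)\overline{u}_t+F(\overline\lambda_t)\boldsymbol{w}_t$,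 $\boldsymbol{x}_0=\overline{x}_0$, with the deterministic parameter sequence started at $\overline\lambda_0$ and given by $\overline\lambda_{t+1}=l_\lambda(q_{t+1},t,\overline\lambda_t)$ for $0\le t\le\tau-2$. A probability measure $\mathbb{P}$ is log-concave if for all (non-empty) convex Borel sets $\mathcal{G}_A,\mathcal{G}_B$ and $\zeta\in[0,1]$, $\mathbb{P}(\zeta\mathcal{G}_A\oplus(1-\zeta)\mathcal{G}_B)\ge\mathbb{P}(\mathcal{G}_A)^\zeta\,\mathbb{P}(\mathcal{G}_B)^{1-\zeta}$, where $\oplus$ is the Minkowski sum. *)

(* Defs.v *)
From HB Require Import structures.
From mathcomp Require Import all_boot all_order all_algebra finmap.
From mathcomp Require Import all_classical all_reals all_analysis.
Set Implicit Arguments.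
Unset Strict Implicit.
Unset Printing Implicit Defensive.
Import Order.TTheory GRing.Theory Num.Theory.
Import numFieldNormedType.Exports.
Local Open Scope classical_set_scope.
Local Open Scope ring_scope.

(* R^n is 'cV[R]_n; as a measurable space it carries its Borel sigma-algebra. *)
Notation borelVec R n := (g_sigma_algebraType (@open 'cV[R]_n)).

Section lebesgueVec.
Variable R : realType.
Notation T1 := (measurableTypeR R).

Definition cons_pair n (xv : T1 * n.-tuple T1) : n.+1.-tuple T1 :=
  [tuple of xv.1 :: xv.2].

Lemma measurable_cons_pair n : measurable_fun setT (@cons_pair n).
Proof. exact: measurable_cons. Qed.

Section step.
Variables (n : nat) (mu : {sigma_finite_measure set (n.-tuple T1) -> \bar R}).

Definition lebesgue_cons : set (n.+1.-tuple T1) -> \bar R :=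
  pushforward (@lebesgue_measure R \x mu)%E (@cons_pair n).

Let mcons := @measurable_cons_pair n.
Let lebesgue_cons0 : lebesgue_cons set0 = 0%E. Proof. exact: measure0. Qed.
Let lebesgue_cons_ge0 A : (0 <= lebesgue_cons A)%E.
Proof. exact: measure_ge0. Qed.
Let lebesgue_cons_sigma_additive : semi_sigma_additive lebesgue_cons.
Proof. exact: measure_semi_sigma_additive. Qed.

HB.instance Definition _ := isMeasure.Build _ _ _ lebesgue_cons
  lebesgue_cons0 lebesgue_cons_ge0 lebesgue_cons_sigma_additive.

Let lebesgue_cons_sigma_finite : sigma_finite setT lebesgue_cons.
Proof.
have /sigma_finiteP[F [FT ndF Foo]] := sigma_finiteT (@lebesgue_measure R).
have /sigma_finiteP[G [GT ndG Goo]] := sigma_finiteT mu.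
pose hd (t : n.+1.-tuple T1) : T1 := tnth t ord0.
pose tl (t : n.+1.-tuple T1) : n.-tuple T1 := [tuple of behead t].
exists (fun k => hd @^-1` F k `&` tl @^-1` G k) => [|k].
  apply/esym; rewrite -subTset => t _.
  have [i _ Fi] : (\bigcup_i F i) (hd t) by rewrite -FT.
  have [j _ Gj] : (\bigcup_i G i) (tl t) by rewrite -GT.
  exists (maxn i j) => //; split => /=.
    by move: Fi; exact/subsetPset/ndF/leq_maxl.
  by move: Gj; exact/subsetPset/ndG/leq_maxr.
have [mF Fk] := Foo k; have [mG Gk] := Goo k; split.
  apply: measurableI; rewrite -[X in measurable X]setTI.
    exact: measurable_tnth.
  exact: measurable_behead.
rewrite /lebesgue_cons /pushforward.
rewrite (_ : _ @^-1` _ = F k `*` G k); last first.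
  apply/seteqP; split => -[a v] [/= Fa Gv]; split => //=.
    by move: Gv; congr (G k); exact/val_inj.
  by move: Gv; congr (G k); exact/val_inj.
by rewrite product_measure1E// lte_mul_pinfty// ge0_fin_numE.
Qed.

HB.instance Definition _ := @Measure_isSigmaFinite.Build _ _ _
  lebesgue_cons lebesgue_cons_sigma_finite.

End step.

Fixpoint lebesgue_tuple n :
    {sigma_finite_measure set (n.-tuple T1) -> \bar R} :=
  match n with
  | 0 => dirac ([tuple] : 0.-tuple T1)
  | n'.+1 => lebesgue_cons (lebesgue_tuple n')
  end.

Definition col_tuple n (t : n.-tuple T1) : borelVec R n := \col_i tnth t i.

Lemma measurable_col_tuple n : measurable_fun setT (@col_tuple n).
Proof.
apply: measurability; first by [].
move=> _ [U oU <-]; rewrite setTI.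
pose B (q : n.-tuple rat * nat) : set (n.-tuple T1) :=
  \bigcap_(i in [set: 'I_n])
     ((fun t => tnth t i) @^-1` ball (ratr (tnth q.1 i) : R) q.2.+1%:R^-1).
pose D := [set q | forall t, B q t -> U (col_tuple t)].
rewrite (_ : _ @^-1` _ = \bigcup_(q in D) B q).
  rewrite bigcup_mkcond; apply: countable_bigcupT_measurable => [|q].
    exact: countableP.
  case: ifPn => // _; apply: fin_bigcap_measurable => // i _.
  rewrite -[X in measurable X]setTI; apply: measurable_tnth => //.
  exact: measurable_realfun.measurable_ball.
apply/seteqP; split => [t Ut|t [q Dq Bt]]; last exact: Dq.
have /nbhs_ballP[e /= e0 eU] : nbhs (col_tuple t : 'cV[R]_n) U.
  exact: open_nbhs_nbhs.
have [k _ /(_ k (leqnn k))/= ke] :=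
  near_infty_natSinv_lt (PosNum (divr_gt0 e0 (ltr0Sn R 1))).
have /choice[f fP] (i : 'I_n) :
    exists r : rat, `|ratr r - tnth t i| < k.+1%:R^-1 :> R.
  have /rat_in_itvoo[r] : tnth t i - k.+1%:R^-1 < tnth t i + k.+1%:R^-1 :> R.
    by rewrite ltrD2l gtrN.
  by move=> /itvP rP; exists r; rewrite ltr_distl !rP.
exists (mktuple f, k) => [s Bs|i _]; last first.
  by rewrite /= /ball /= tnth_mktuple.
apply: eU; split => // i j; rewrite !mxE.
have := Bs i I; rewrite /ball /= tnth_mktuple => si.
rewrite (splitr e); apply: le_lt_trans (ler_distD (ratr (f i)) _ _) _.
by rewrite ltrD// ?(lt_trans _ ke)// distrC.
Qed.

(* Lebesgue measure on R^n: the n-fold product of the one-dimensional one,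
   transported to column vectors. *)
Definition lebesgueVec n : set (borelVec R n) -> \bar R :=
  pushforward (lebesgue_tuple n) (@col_tuple n).

Section lebesgueVec_measure.
Variable n : nat.

Let mcol := @measurable_col_tuple n.
Let lebesgueVec0 : @lebesgueVec n set0 = 0%E. Proof. exact: measure0. Qed.
Let lebesgueVec_ge0 A : (0 <= @lebesgueVec n A)%E.
Proof. exact: measure_ge0. Qed.
Let lebesgueVec_sigma_additive : semi_sigma_additive (@lebesgueVec n).
Proof. exact: measure_semi_sigma_additive. Qed.

HB.instance Definition _ := isMeasure.Build _ _ _ (@lebesgueVec n)
  lebesgueVec0 lebesgueVec_ge0 lebesgueVec_sigma_additive.

End lebesgueVec_measure.

Lemma lebesgueVec_box n (A : 'I_n -> set T1) : (forall i, measurable (A i)) ->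
  @lebesgueVec n [set x | forall i, A i (x i ord0)] =
  (\prod_(i < n) @lebesgue_measure R (A i))%E.
Proof.
rewrite /lebesgueVec /pushforward /= => mA.
rewrite (_ : _ @^-1` _ = [set t | forall i, A i (tnth t i)]); last first.
  by apply/seteqP; split => t At i; have := At i; rewrite mxE.
elim: n A mA => [|n IHn] A mA.
  by rewrite big_ord0 /= diracE mem_set //= => -[].
rewrite big_ord_recl /= /lebesgue_cons /pushforward.
pose B : set (n.-tuple T1) := [set t | forall i, A (lift ord0 i) (tnth t i)].
have mB : measurable B.
  rewrite (_ : B = \bigcap_(i in [set: 'I_n])
      ((@tnth _ _)^~ i @^-1` A (lift ord0 i))).
    apply: fin_bigcap_measurable => // i _.
    by rewrite -[X in measurable X]setTI; exact: measurable_tnth.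
  by apply/seteqP; split => t /= At i => [_|]; exact: At.
rewrite (_ : _ @^-1` _ = A ord0 `*` B).
  by rewrite product_measure1E//; congr (_ * _)%E; exact: IHn.
apply/seteqP; split => -[a v] /= => [Aav|[Aa Av] i].
  split => [|i]; first exact: (Aav ord0).
  by have := Aav (lift ord0 i); rewrite tnthS.
by case: (unliftP ord0 i) => [j|] -> //; rewrite tnthS; exact: Av.
Qed.

End lebesgueVec.
Arguments lebesgueVec : clear implicits.

Section probability_notions.
Context d (T : measurableType d) (R : realType) (P : probability T R).

Definition cond_prob (A B : set T) : R := fine (P (A `&` B)) / fine (P B).

(* Time-inhomogeneous Markov chain sigma_0, ..., sigma_N in a finite set. *)
Definition markov_chain (Q : finType) (N : nat) (sigma : nat -> T -> Q) :=
  (forall t q, (t <= N)%N -> measurable (sigma t @^-1` [set q])) /\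
  (forall t, (t < N)%N -> forall q : nat -> Q,
    let past := [set om | forall i, (i <= t)%N -> sigma i om = q i] in
    (0 < P past)%E ->
    cond_prob (sigma t.+1 @^-1` [set q t.+1]) past =
    cond_prob (sigma t.+1 @^-1` [set q t.+1]) (sigma t @^-1` [set q t])).

(* The product rule for subfamilies is the case E t = setT for some t's. *)
Definition mutually_independent (p N : nat) (w : nat -> T -> borelVec R p) :=
  forall E : 'I_N -> set (borelVec R p), (forall t, measurable (E t)) ->
  P [set om | forall t : 'I_N, E t (w t om)] =
  (\prod_(t < N) P (w t @^-1` E t))%E.

Definition mode_events (Q : finType) N (sigma : nat -> T -> Q) : set (set T) :=
  <<s [set A | exists t q, (t <= N)%N /\ A = sigma t @^-1` [set q]] >>.

Definition noise_events p N (w : nat -> T -> borelVec R p) : set (set T) :=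
  <<s [set A | exists t E,
         [/\ (t < N)%N, measurable E & A = w t @^-1` E]] >>.

Definition independent_processes (Q : finType) (p N : nat)
    (sigma : nat -> T -> Q) (w : nat -> T -> borelVec R p) :=
  forall A B, mode_events N sigma A -> noise_events N w B ->
  P (A `&` B) = (P A * P B)%E.

End probability_notions.

Definition has_density (R : realType) (p : nat)
    (mu : probability (borelVec R p) R) :=
  exists f : borelVec R p -> R,
    [/\ measurable_fun setT f, (forall x, 0 <= f x) &
        forall E, measurable E ->
          mu E = (\int[lebesgueVec R p]_(x in E) (f x)%:E)%E].

Definition minkowski_sum (R : realType) (p : nat) (A B : set 'cV[R]_p) :
    set 'cV[R]_p :=
  [set a + b | a in A & b in B].

(* The Minkowski sum of two convex Borel sets need not be Borel, hence need not
   be in the domain of mu: the inequality is required whenever it is. *)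
Definition log_concave (R : realType) (p : nat)
    (mu : probability (borelVec R p) R) :=
  forall (A B : set (borelVec R p)) (zeta : R),
    measurable A -> measurable B ->
    @convex_set R 'cV[R]_p A -> @convex_set R 'cV[R]_p B ->
    A !=set0 -> B !=set0 -> 0 <= zeta <= 1 ->
    let C : set (borelVec R p) :=
      minkowski_sum [set zeta *: a | a in A] [set (1 - zeta) *: b | b in B] in
    measurable C ->
    (mu A `^ zeta * mu B `^ (1 - zeta) <= mu C)%E.

(* Deterministic data of the system.  Functions of time are given on all of
   nat, but only their values at t < N are used up to the horizon N.  Since
   modes and params are finite, next_param is automatically Borel. *)
Record dmsp (R : realType) (n m p l : nat) := Dmsp {
  modes : {fset R};
  params : {fset 'cV[R]_l};
  matA : params -> 'M[R]_n;
  matB : params -> 'M[R]_(n, m);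
  matF : params -> 'M[R]_(n, p);
  next_param : modes -> nat -> params -> params;
  mode0 : modes;
  param0 : params;
  state0 : 'cV[R]_n;
  input : nat -> 'cV[R]_m }.

Section trajectories.
Variables (R : realType) (n m p l : nat) (S : dmsp R n m p l).

(* q 0 is not used: the parameter starts at param0. *)
Fixpoint param_traj (q : nat -> modes S) (t : nat) : params S :=
  if t is t'.+1 then next_param (q t) t' (param_traj q t') else param0 S.

Fixpoint state_traj (lam : nat -> params S) (w : nat -> 'cV[R]_p) (t : nat) :
    'cV[R]_n :=
  if t is t'.+1 then
    matA (lam t') *m state_traj lam w t' + matB (lam t') *m input S t' +
    matF (lam t') *m w t'
  else state0 S.

End trajectories.

Section occupancy.
Variables (R : realType) (n m p l : nat) (S : dmsp R n m p l).
Context d (T : measurableType d) (P : probability T R).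
Variables (sigma : nat -> T -> modes S) (w : nat -> T -> borelVec R p).
Variable h_obs : 'cV[R]_n -> R.

Definition obstacle (c : 'cV[R]_n) : set 'cV[R]_n :=
  [set z | 0 <= h_obs (z - c)].

Definition opp_set (G : set 'cV[R]_n) : set 'cV[R]_n := [set z | G (- z)].

Definition dmsp_state (t : nat) (om : T) : 'cV[R]_n :=
  state_traj (param_traj (sigma ^~ om)) (w ^~ om) t.

Definition occupy_prob (tau : nat) (y : 'cV[R]_n) : \bar R :=
  P [set om | (\bigcup_(q in [set: modes S])
                 ([set q] `*` opp_set (obstacle (- y))))
              (sigma tau om, dmsp_state tau om)].

Definition PrOccupySetS (alpha : R) (tau : nat) : set 'cV[R]_n :=
  [set y | (alpha%:E <= occupy_prob tau y)%E].

(* qs = [:: q_1; ...; q_(tau - 1)]; prepending mode0 makes q_t its t-th item. *)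
Definition path_state (qs : seq (modes S)) (t : nat) (om : T) : 'cV[R]_n :=
  state_traj (param_traj (nth (mode0 S) (mode0 S :: qs))) (w ^~ om) t.

Definition PrOccupySetP (beta : R) (tau : nat) (qs : seq (modes S)) :
    set 'cV[R]_n :=
  [set y | (beta%:E <=
    P [set om | opp_set (obstacle (- y)) (path_state qs tau om)])%E].

Definition path_event (tau : nat) (q : tau.-tuple (modes S)) : set T :=
  [set om | forall i : 'I_tau, sigma i.+1 om = tnth q i].

Definition positive_paths (tau : nat) : {set tau.-tuple (modes S)} :=
  finset (fun q => (0 < P (path_event q))%E).

Definition alphaS (alpha : R) (tau : nat) (q : tau.-tuple (modes S)) : R :=
  alpha / (#|positive_paths tau|%:R * fine (P (path_event q))).

End occupancy.

(* Main.v *)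
(* Write O for the obstacle at the origin.  The set attached to a mode path is
   the superlevel set of y |-> P(y - x in O), where x is the state along that
   path.  The law of x is log-concave on closed convex sets: x(t+1) is an affine
   function of the independent pair (w(t), x(t)), and integrating over w(t) calls
   for a Prekopa-Leindler inequality for the law of w(t).  That inequality is
   derived from the set form of log-concavity, without densities: with
   F(v) = e^(-v) mu {e^(-v) <= f}, whose integral is that of f, it becomes the
   one-dimensional Prekopa-Leindler inequality for Lebesgue measure, itself a
   consequence of |A| + |B| <= |A + B| on the line.  Since all the superlevel
   sets involved are closed, midpoints suffice.  The covering splits the event
   over mode paths and uses that modes and disturbances are independent. *)
Require Import Defs.
From HB Require Import structures.
From mathcomp Require Import all_boot all_order all_algebra finmap.
From mathcomp Require Import all_classical all_reals all_analysis.
From mathcomp Require Import measurable_realfun ring lra.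
Set Implicit Arguments.
Unset Strict Implicit.
Unset Printing Implicit Defensive.
Import Order.TTheory GRing.Theory Num.Theory.
Import numFieldNormedType.Exports.
Local Open Scope classical_set_scope.
Local Open Scope ring_scope.

(** * Layer-cake formulas and inequalities on the real line *)

Lemma measurable_superlevel d (W : measurableType d) (R : realType)
    (f : W -> R) (r : R) :
  measurable_fun setT f -> measurable [set w | r <= f w].
Proof.
move=> mf; rewrite (_ : [set w | _] = f @^-1` `[r, +oo[%classic).
  by rewrite -[X in measurable X]setTI; exact: mf.
by apply/seteqP; split=> w /=; rewrite in_itv/= andbT.
Qed.

Section layer_cake.
Context d (W : measurableType d) (R : realType)
  (mu : {sigma_finite_measure set W -> \bar R}).
Local Notation leb := (@lebesgue_measure R).
Variables (f : W -> R) (theta kappa : R -> R).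
Hypotheses (mf : measurable_fun setT f)
  (mtheta : measurable_fun setT (theta : measurableTypeR R -> measurableTypeR R))
  (mkappa : measurable_fun setT (kappa : measurableTypeR R -> measurableTypeR R))
  (kappa_ge0 : forall v, 0 <= kappa v).

Lemma measurable_hypograph :
  measurable [set z : W * measurableTypeR R | theta z.2 <= f z.1].
Proof.
rewrite -[X in measurable X]setTI.
rewrite (_ : [set z | _] = (fun z => theta z.2 <= f z.1) @^-1` [set true]) //.
apply: measurable_fun_ler => //.
  exact: measurableT_comp mtheta measurable_snd.
exact: measurableT_comp mf measurable_fst.
Qed.

Lemma measurable_superlevel_measure :
  measurable_fun setT
    (fun v : measurableTypeR R => mu [set w | theta v <= f w]).
Proof.
have /(@measurable_fun_ysection _ _ _ _ _ mu) := measurable_hypograph.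
by apply: eq_measurable_fun => v _ /=; congr (mu _); apply/seteqP; split=> w;
  rewrite /ysection /= inE.
Qed.

(** Tonelli for the weight [kappa v] on the hypograph [theta v <= f w]: integrating in v first gives
    back [f w] by the hypothesis. Free [theta] and [kappa] cover both plain levels in ]0, 1[ and
    exponential levels. *)
Lemma integral_layer_cake :
  (forall w, (\int[leb]_(v in [set v | (theta v <= f w)%R]) (kappa v)%:E
    = (f w)%:E)%E) ->
  (\int[mu]_w (f w)%:E =
   \int[leb]_v ((kappa v)%:E * mu [set w | (theta v <= f w)%R]))%E.
Proof.
move=> fE.
pose E := [set z : W * measurableTypeR R | theta z.2 <= f z.1].
pose k (z : W * measurableTypeR R) := ((kappa z.2)%:E * (\1_E z)%:E)%E.
have mE : measurable E by exact: measurable_hypograph.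
have mk : measurable_fun setT k.
  apply: emeasurable_funM.
    by apply/measurable_EFinP; exact: measurableT_comp mkappa measurable_snd.
  by apply/measurable_EFinP; exact: measurable_indic.
have k0 z : (0 <= k z)%E by rewrite mule_ge0// lee_fin.
have := @fubini_tonelli _ _ _ _ _ mu leb k mk k0.
under eq_integral => w _.
  rewrite (_ : (\int[_]_y _)%E = (f w)%:E).
    over.
  rewrite -fE [RHS]integral_mkcond; apply: eq_integral => v _.
  rewrite /k patchE /= indicE.
  have -> : ((w, v) \in E) = (v \in [set v | theta v <= f w]).
    by apply/idP/idP; rewrite !inE.
  by case: ifP => _; rewrite ?mule1 ?mule0.
move=> ->; apply: eq_integral => v _; rewrite /k /=.
rewrite ge0_integralZl//; last 2 first.
- apply/measurable_EFinP.
  exact: (@measurableT_comp _ _ _ _ _ _ (\1_E : _ -> R)).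
- by rewrite lee_fin.
congr (_ * _)%E.
rewrite (_ : (fun x => _) = (fun x => (\1_[set w | theta v <= f w] x)%:E)).
  rewrite integral_indic//= ?setIT//.
  rewrite (_ : [set w | _] = ysection E v); first exact: measurable_ysection.
  by apply/seteqP; split=> w; rewrite /ysection /= inE.
by apply/funext => w; rewrite !indicE; congr ((nat_of_bool _)%:R%:E);
 apply/idP/idP; rewrite !inE.
Qed.

End layer_cake.

Lemma image_addr (R : zmodType) (a : R) (A : set R) :
  [set x + a | x in A] = (fun x => x - a) @^-1` A.
Proof.
apply/seteqP; split=> [_ [x Ax <-] /=|x /= Ax]; first by rewrite addrK.
by exists (x - a) => //; rewrite subrK.
Qed.

(** Uniqueness of Lebesgue measure: its pushforward by x - a gives half-open intervals their
    length. *)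
Lemma lebesgue_measureD (R : realType) (a : R) (A : set R) : measurable A ->
  lebesgue_measure [set x + a | x in A] = lebesgue_measure A.
Proof.
move=> mA.
have mD : measurable_fun setT
    (fun x : measurableTypeR R => x - a : measurableTypeR R).
  exact: measurable_funB.
rewrite image_addr.
pose g : {mfun measurableTypeR R >-> measurableTypeR R} := 
  HB.pack (fun x : measurableTypeR R => x - a : measurableTypeR R)
    (isMeasurableFun.Build _ _ _ _ _ mD).
apply/esym; apply: (@lebesgue_measure_unique R
  (pushforward lebesgue_measure g)) => //.
move=> _ [[b c]] _ <-.
transitivity (lebesgue_measure (`](b + a), (c + a)]%classic : set R)); last first.
  congr lebesgue_measure; apply/seteqP; split=> x;
  by rewrite /= -?[g x]/(x - a) !in_itv/= ltrBrDr lerBlDr.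
rewrite !lebesgue_measure_itv/= !lte_fin ltrD2r.
by case: ifP => // _; rewrite -!EFinD; congr (_%:E); ring.
Qed.

Lemma measurable_image_addr (R : realType) (a : R) (A : set R) :
  measurable A -> measurable [set x + a | x in A].
Proof.
move=> mA; rewrite image_addr -[X in measurable X]setTI.
exact: measurable_funB.
Qed.

(* If a is close to sup A and b to inf B, the translates a + (B `&` [b, +oo[)
   and b + (A `&` ]-oo, a[) are disjoint subsets of A + B. *)
Lemma brunn_minkowski1 (R : realType) (A B C : set R) (k : R) :
  measurable A -> measurable B -> measurable C -> A !=set0 -> B !=set0 ->
  (forall x, A x -> `|x| <= k) -> (forall x, B x -> `|x| <= k) ->
  (forall x y, A x -> B y -> C (x + y)) ->
  (lebesgue_measure A + lebesgue_measure B <= lebesgue_measure C)%E.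
Proof.
move=> mA mB mC [a0 Aa0] [b0 Bb0] Ak Bk ABC.
have supA : has_sup A.
  by split; [exists a0|exists k => x /Ak; rewrite ler_norml => /andP[]].
have infB : has_inf B.
  by split; [exists b0|exists (- k) => x /Bk; rewrite ler_norml => /andP[]].
apply/lee_addgt0Pr => e e0; have e20 : 0 < e / 2 by rewrite divr_gt0.
have [a Aa ea] := sup_adherent e20 supA.
have [b Bb eb] := inf_adherent e20 infB.
pose A' := A `&` `]-oo, a[%classic; pose B' := B `&` `[b, +oo[%classic.
have mA' : measurable A' by exact: measurableI.
have mB' : measurable B' by exact: measurableI.
have itvE (c : R) :
    lebesgue_measure (`[c, c + e / 2]%classic : set R) = (e / 2)%:E.
  by rewrite lebesgue_measure_itv/= lte_fin ltrDl e20 -EFinD addrAC subrr add0r.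
(* As [a] exceeds sup A - e/2, the part of A cut off at [a] lies in [a, a + e/2]. *)
have leA : (lebesgue_measure A <= lebesgue_measure A' + (e / 2)%:E)%E.
  rewrite -(itvE a); apply: le_trans; last by apply: measureU2.
  apply: le_measure; rewrite ?inE//; first exact: measurableU.
  move=> x Ax; have [xa|ax] := ltP x a; [left|right] => /=; first by split.
  by rewrite in_itv/= ax/=; have := ub_le_sup (proj2 supA) Ax; lra.
have leB : (lebesgue_measure B <= lebesgue_measure B' + (e / 2)%:E)%E.
  rewrite -(itvE (b - e / 2)); apply: le_trans; last by apply: measureU2.
  apply: le_measure; rewrite ?inE//; first exact: measurableU.
  move=> x Bx; have [xb|bx] := ltP x b; [right|left] => /=.
    rewrite in_itv/= subrK (ltW xb) ?andbT.
    by have := ge_inf (proj2 infB) Bx; lra.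
  by split => //=; rewrite in_itv/= bx.
have leC : (lebesgue_measure A' + lebesgue_measure B' <= lebesgue_measure C)%E.
  rewrite -(lebesgue_measureD b mA') -(lebesgue_measureD a mB') -measureU//.
  - apply: le_measure; rewrite ?inE//.
      by apply: measurableU; exact: measurable_image_addr.
    move=> _ [[x [Ax _] <-]|[x [Bx _] <-]]; first exact: ABC.
    by rewrite addrC; exact: ABC.
  - exact: measurable_image_addr.
  - exact: measurable_image_addr.
  (* The translate of [A'] lies strictly to the left of a + b, that of [B'] does not. *)
  - rewrite -subset0 => _ [[x [_ /= xa] <-] [y [_ /= yb] xy]].
    by move: xa yb; rewrite !in_itv/= andbT; lra.
apply: le_trans (leeD leA leB) _.
by rewrite addeACA -EFinD -splitr leeD2r.
Qed.

Lemma integral_layer_cake01 d (W : measurableType d) (R : realType)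
    (mu : {sigma_finite_measure set W -> \bar R}) (f : W -> R) :
  measurable_fun setT f -> (forall w, 0 <= f w <= 1) ->
  (\int[mu]_w (f w)%:E =
   \int[lebesgue_measure]_(v in `]0%R, 1%R[) mu [set w | (v <= f w)%R])%E.
Proof.
move=> mf f01.
rewrite (@integral_layer_cake _ _ _ _ _ id
  (\1_`]0, 1[%classic : R -> R))//; first last.
- move=> w; have /andP[f0 f1] := f01 w; rewrite integral_indic//; last first.
    by rewrite -set_itvNyc//; exact: measurable_itv.
  have [fw|fw] := ltP (f w) 1.
    rewrite (_ : _ `&` _ = `]0, f w]%classic).
      rewrite -[LHS]/(lebesgue_measure (`]0, f w]%classic : set R)).
      rewrite lebesgue_measure_itv/= lte_fin.
      case: ltP => fw0; first by rewrite oppr0 adde0.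
      by congr (_%:E); apply/le_anti; rewrite f0 fw0.
    apply/seteqP; split=> x /=; rewrite !in_itv/=; first by case=> /andP[-> _] ->.
    by case/andP=> -> xf; rewrite (le_lt_trans xf).
  rewrite (_ : _ `&` _ = `]0, 1[%classic).
    rewrite -[LHS]/(lebesgue_measure (`]0, 1[%classic : set R)).
    rewrite lebesgue_measure_itv/= lte_fin ltr01 oppr0 adde0.
    by congr (_%:E); apply/le_anti; rewrite f1 fw.
  apply/seteqP; split=> x /=; rewrite !in_itv/=; first by case.
  by case/andP=> -> x1; rewrite x1; split=> //; rewrite (le_trans (ltW x1)).
rewrite [RHS]integral_mkcond; apply: eq_integral => v _.
by rewrite patchE indicE; case: ifP => _; rewrite ?mul1e ?mul0e.
Qed.

(** The point u + v replaces the midpoint, which doubles the integral of h and accounts for the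
    factor 4. Level sets are asked to be bounded because [brunn_minkowski1] takes bounded sets. *)
Lemma prekopa_leindler1 (R : realType) (f g h : R -> R) (a b c : R) :
  measurable_fun setT f -> measurable_fun setT g -> measurable_fun setT h ->
  (forall u, 0 <= f u <= 1) -> (forall u, 0 <= g u <= 1) ->
  (forall u, 0 <= h u) ->
  (forall r : R, 0 < r -> exists k : R, forall u, r <= f u -> `|u| <= k) ->
  (forall r : R, 0 < r -> exists k : R, forall u, r <= g u -> `|u| <= k) ->
  (forall u v, f u * g v <= h (u + v) ^+ 2) ->
  (\int[lebesgue_measure]_u (f u)%:E = a%:E)%E ->
  (\int[lebesgue_measure]_u (g u)%:E = b%:E)%E ->
  (\int[lebesgue_measure]_u (h u)%:E = c%:E)%E ->
  4 * (a * b) <= c ^+ 2.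
Proof.
move=> mf mg mh f01 g01 h0 fk gk fgh fa gb hc.
have a0 : 0 <= a.
  rewrite -lee_fin -fa integral_ge0// => u _.
  by rewrite lee_fin; case/andP: (f01 u).
have b0 : 0 <= b.
  rewrite -lee_fin -gb integral_ge0// => u _.
  by rewrite lee_fin; case/andP: (g01 u).
have [->|a_neq0] := eqVneq a 0; first by rewrite mul0r mulr0 sqr_ge0.
have [->|b_neq0] := eqVneq b 0; first by rewrite !mulr0 sqr_ge0.
(* A nonpositive supremum would force phi = 0 and a zero integral. The supremum may not be attained,
   hence r < 1, which is enough for levels in ]0, 1[. *)
have sup_pos (phi : R -> R) (e : R) : (forall u, 0 <= phi u <= 1) -> e != 0 ->
    (\int[lebesgue_measure]_u (phi u)%:E = e%:E)%E ->
    [/\ 0 < sup (range phi), forall u, phi u <= sup (range phi) &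
        forall r, r < 1 -> exists u, r * sup (range phi) <= phi u].
  move=> phi01 e0 phie.
  have phisup : has_sup (range phi).
    by split; [exists (phi 0), 0|exists 1 => _ [u _ <-]; case/andP: (phi01 u)].
  have phile u : phi u <= sup (range phi).
    by apply: ub_le_sup; [case: phisup|exists u].
  have pos : 0 < sup (range phi).
    rewrite ltNge; apply/negP => sup0; move/eqP: e0; apply.
    apply/EFin_inj; rewrite -phie; apply: integral0_eq => u _; congr (_%:E).
    by apply/le_anti; case/andP: (phi01 u) => -> _; rewrite (le_trans (phile u)).
  split=> // r r1.
  have s1 : 0 < (1 - r) * sup (range phi) by rewrite mulr_gt0// subr_gt0.
  have [_ [u _ <-] ru] := sup_adherent s1 phisup.
  by exists u; apply: ltW; apply: le_lt_trans ru; lra.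
have [M0 fM fr] := sup_pos f a f01 a_neq0 fa.
have [L0 gL gr] := sup_pos g b g01 b_neq0 gb.
set M := sup (range f) in M0 fM fr; set L := sup (range g) in L0 gL gr.
pose s := Num.sqrt (M * L).
have s0 : 0 < s by rewrite sqrtr_gt0 mulr_gt0.
have s2 : s ^+ 2 = M * L by rewrite sqr_sqrtr// ltW// mulr_gt0.
pose f' u := M^-1 * f u; pose g' u := L^-1 * g u.
pose h' u := Num.min (s^-1 * h u) 1.
have mf' : measurable_fun setT f' by exact: measurable_funM.
have mg' : measurable_fun setT g' by exact: measurable_funM.
have msh : measurable_fun setT (fun u => s^-1 * h u).
  exact: measurable_funM.
have mh' : measurable_fun setT h' by exact: measurable_minr.
have f'01 u : 0 <= f' u <= 1.
  rewrite /f' mulr_ge0 ?invr_ge0 ?(ltW M0)//=; last by case/andP: (f01 u).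
  by rewrite mulrC ler_pdivrMr// mul1r.
have g'01 u : 0 <= g' u <= 1.
  rewrite /g' mulr_ge0 ?invr_ge0 ?(ltW L0)//=; last by case/andP: (g01 u).
  by rewrite mulrC ler_pdivrMr// mul1r.
have sh0 u : 0 <= s^-1 * h u by rewrite mulr_ge0// invr_ge0 ltW.
have h'01 u : 0 <= h' u <= 1 by rewrite /h' le_min ler01 sh0 ge_min lexx orbT.
have mlev (phi : R -> R) : measurable_fun setT phi ->
    measurable_fun (`]0%R, 1%R[%classic : set (measurableTypeR R))
    (fun v : measurableTypeR R =>
      lebesgue_measure [set w : measurableTypeR R | v <= phi w]).
  move=> mphi; apply: measurable_funTS.
  apply: (@measurable_superlevel_measure _ _ _ (@lebesgue_measure R) phi id mphi).
  exact: measurable_id.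
(* Normalizing f, g and h by M, L and sqrt (M L) makes the level sets of f
   and g nonempty below 1, and the sum of those at a common height lies in the
   level set of h at that height. *)
have key : ((M^-1 * a + L^-1 * b)%:E <= (s^-1 * c)%:E)%E.
  have -> : ((s^-1 * c)%:E = \int[lebesgue_measure]_u (s^-1 * h u)%:E)%E.
    under eq_integral do rewrite EFinM.
    rewrite ge0_integralZl//; last 3 first.
    - exact/measurable_EFinP.
    - by move=> u _; rewrite lee_fin.
    - by rewrite lee_fin invr_ge0 ltW.
    by rewrite hc.
  apply: (@le_trans _ _ (\int[lebesgue_measure]_u (h' u)%:E)%E); last first.
    apply: ge0_le_integral => //.
    - by move=> u _; rewrite lee_fin; case/andP: (h'01 u).
    - exact/measurable_EFinP.
    - exact/measurable_EFinP.
    - by move=> u _; rewrite lee_fin ge_min lexx.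
  have -> : ((M^-1 * a + L^-1 * b)%:E = \int[lebesgue_measure]_u (f' u)%:E +
     \int[lebesgue_measure]_u (g' u)%:E)%E.
    rewrite EFinD !EFinM -fa -gb; congr (_ + _)%E.
      rewrite -ge0_integralZl//; first exact/measurable_EFinP.
      - by move=> u _; rewrite lee_fin; case/andP: (f01 u).
      - by rewrite lee_fin invr_ge0 ltW.
    rewrite -ge0_integralZl//; first exact/measurable_EFinP.
    - by move=> u _; rewrite lee_fin; case/andP: (g01 u).
    - by rewrite lee_fin invr_ge0 ltW.
  rewrite !integral_layer_cake01// -ge0_integralD//; last 2 first.
  - exact: mlev.
  - exact: mlev.
  apply: ge0_le_integral => //.
  - by move=> r _; rewrite adde_ge0.
  - apply: emeasurable_funD; exact: mlev.
  - exact: mlev.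
  move=> r; rewrite /= in_itv/= => /andP[r0 r1].
  have [k1 fk1] := fk (r * M) (mulr_gt0 r0 M0).
  have [k2 gk2] := gk (r * L) (mulr_gt0 r0 L0).
  have f'E u : (r <= f' u) = (r * M <= f u) by rewrite /f' mulrC ler_pdivlMr.
  have g'E u : (r <= g' u) = (r * L <= g u) by rewrite /g' mulrC ler_pdivlMr.
  apply: (@brunn_minkowski1 _ _ _ _ (Num.max k1 k2));
    [exact: measurable_superlevel..| | | | |].
  - by have [u] := fr r r1; rewrite -f'E; exists u.
  - by have [u] := gr r r1; rewrite -g'E; exists u.
  - by move=> u /=; rewrite f'E le_max => /fk1 ->.
  - by move=> u /=; rewrite g'E le_max => /gk2 ->; rewrite orbT.
  move=> u v /=; rewrite f'E g'E => fu gv; rewrite le_min (ltW r1) andbT.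
  rewrite mulrC ler_pdivlMr//; rewrite -(@ler_pXn2r _ 2)// ?nnegrE//; last first.
    by rewrite mulr_ge0// ltW.
  apply: le_trans (fgh u v); rewrite exprMn s2 expr2 mulrACA.
  by apply: ler_pM => //; rewrite mulr_ge0// ltW.
rewrite lee_fin in key.
have c_ge : (M^-1 * a + L^-1 * b) * s <= c.
  by rewrite -ler_pdivlMr// [c / s]mulrC.
apply: (@le_trans _ _ (((M^-1 * a + L^-1 * b) * s) ^+ 2)); last first.
  rewrite ler_pXn2r// ?nnegrE.
    by rewrite mulr_ge0 ?(ltW s0)// addr_ge0// mulr_ge0// invr_ge0 ltW.
  apply: le_trans c_ge.
  by rewrite mulr_ge0 ?(ltW s0)// addr_ge0// mulr_ge0// invr_ge0 ltW.
rewrite exprMn s2.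
(* AM-GM: [4 x y <= (x + y)^2] with [x = a / M] and [y = b / L]. *)
have -> : 4 * (a * b) = 4 * ((M^-1 * a) * (L^-1 * b)) * (M * L).
  by field; rewrite !gt_eqF.
apply: ler_wpM2r; first by rewrite ltW// mulr_gt0.
rewrite -subr_ge0.
by rewrite [X in 0 <= X](_ : _ = (M^-1 * a - L^-1 * b) ^+ 2) ?sqr_ge0//; ring.
Qed.

(** * Topology, measurability and convexity of column vectors *)

Lemma continuous_mx (U : topologicalType) (R : realType) m n
    (f : U -> 'M[R]_(m, n)) :
  (forall i j, continuous (fun x => f x i j)) -> continuous f.
Proof.
move=> cf x A [B fB BA]; rewrite /nbhs/=.
apply: (@filterS _ _ _ [set y | forall i j, B i j (f y i j)]).
  by move=> y /BA.
apply: filter_forall => i; apply: filter_forall => j.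
exact: (cf i j x (B i j) (fB i j)).
Qed.

Lemma continuous_mulmxl (R : realType) m n k (M : 'M[R]_(m, n)) :
  continuous (fun x : 'M[R]_(n, k) => M *m x).
Proof.
apply: continuous_mx => i j.
rewrite (_ : (fun x => _) = fun x : 'M[R]_(n, k) => \sum_l M i l * x l j).
  apply: continuous_big => [|l _ x].
    exact: add_continuous.
  by apply: continuousM; [exact: cst_continuous|exact: coord_continuous].
by apply/funext => x; rewrite mxE.
Qed.

Lemma continuous_affine (R : realType) m n k (M : 'M[R]_(m, n))
    (b : 'M[R]_(m, k)) :
  continuous (fun x : 'M[R]_(n, k) => M *m x + b).
Proof.
apply: continuous_mx => i j x; 
  rewrite (_ : (fun x => _) = fun x => (M *m x) i j + b i j).
  apply: (@cvgD _ R^o _ (nbhs x) _ (fun y => (M *m y) i j) (fun=> b i j));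
    last exact: cvg_cst.
  have cM := @continuous_mulmxl R m n k M x.
  exact: (continuous_comp cM (@coord_continuous R m k i j (M *m x))).
by apply/funext => y; rewrite mxE.
Qed.

(** Closed bounded sets of row vectors are compact, and transposition is continuous and compatible
    with the norm. *)
Lemma compact_cV (R : realType) n (A : set 'cV[R]_n) (k : R) :
  closed A -> (forall x, A x -> `|x| <= k) -> compact A.
Proof.
move=> cA Ak.
have ctr a b : continuous (fun x : 'M[R]_(a, b) => x^T).
  apply: continuous_mx => i j x.
  rewrite (_ : (fun x => _) = (fun x : 'M[R]_(a, b) => x j i)).
    exact: coord_continuous.
  by apply/funext => y; rewrite mxE.
rewrite (_ : A = trmx @` (trmx @^-1` A)); last first.
  apply/seteqP; split=> [x Ax|_ [x xA <-] //].
  by exists x^T => /=; rewrite ?trmxK.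
apply: continuous_compact; first by apply: continuous_subspaceT; exact: ctr.
apply: bounded_closed_compact; last first.
  by apply: preimage_closed => // x _; exact: ctr.
exists k; split; first exact: num_real.
move=> r kr x /= /Ak xk; apply: le_trans (ltW kr); apply: le_trans xk.
rewrite -[x in X in X <= _]trmxK.
rewrite [leLHS]/Num.norm/= !mx_normrE; apply/bigmax_leP.
split=> [|[i j] _] //=.
rewrite mxE [leRHS]/Num.norm/= mx_normrE.
by apply/bigmax_geP; right => /=; exists (j, i).
Qed.

Lemma closed_measurable_borelVec (R : realType) n (A : set 'cV[R]_n) :
  closed A -> measurable (A : set (borelVec R n)).
Proof.
move=> cA; rewrite -[A]setCK; apply: measurableC.
by apply: sub_sigma_algebra; exact: closed_openC.
Qed.

Lemma measurable_coord (R : realType) n (i : 'I_n) :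
  measurable_fun setT (fun x : borelVec R n => x i ord0 : R).
Proof.
apply: measurability; first exact: RGenOpens.measurableE.
move=> _ [_ [a [b ->]] <-]; rewrite setTI; apply: sub_sigma_algebra.
apply: open_comp => [x _|]; first exact: coord_continuous.
exact: interval_open.
Qed.

(** The map factors through the tuple of its coordinates, and [measurable_col_tuple] passes from the
    product sigma-algebra to the Borel one. *)
Lemma measurable_fun_borelVec d (U : measurableType d) (R : realType) n
    (f : U -> borelVec R n) :
  (forall i, measurable_fun setT (fun x => f x i ord0 : measurableTypeR R)) ->
  measurable_fun setT f.
Proof.
move=> mf.
pose g (x : U) : n.-tuple (measurableTypeR R) := [tuple f x i ord0 | i < n].
rewrite (_ : f = @col_tuple R n \o g).
  apply: measurableT_comp; first exact: measurable_col_tuple.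
  apply/measurable_fun_tnthP => i; apply: eq_measurable_fun (mf i) => x _ /=.
  by rewrite tnth_mktuple.
by apply/funext => x; apply/colP => i; rewrite !mxE tnth_mktuple.
Qed.

(** The points of A nearest to t on either side exist by closedness. Their midpoint is in A and lies
    on one of the sides, so the two points coincide, and they equal t. *)
Lemma closed_midpoint_itv (R : realType) (A : set R) :
  closed A -> A 0 -> A 1 -> (forall s t, A s -> A t -> A ((s + t) / 2)) ->
  forall t, 0 <= t <= 1 -> A t.
Proof.
move=> cA A0 A1 Amid t /andP[t0 t1].
pose L := A `&` `]-oo, t]%classic; pose U := A `&` `[t, +oo[%classic.
have supL : has_sup L.
  split; first by exists 0; split => //=; rewrite in_itv/=.
  by exists t => x [_] /=; rewrite in_itv/=.
have infU : has_inf U.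
  split; first by exists 1; split => //=; rewrite in_itv/= t1.
  by exists t => x [_] /=; rewrite in_itv/= andbT.
have [AL Lt] : L (sup L).
  have cL : closed L by apply: closedI => //; exact: interval_closed.
  by apply: cL; apply: closure_sup; case: supL.
have [AU Ut] : U (inf U).
  have cU : closed U by apply: closedI => //; exact: interval_closed.
  apply: cU => V /nbhs_ballP[e /= e0 eV].
  have [x Ux xe] := inf_adherent e0 infU; exists x; split=> //; apply: eV.
  by rewrite /ball/= ler0_norm ?subr_le0 ?(ge_inf (proj2 infU))//; lra.
have := Amid _ _ AL AU.
move: Lt Ut; rewrite /= !in_itv/= andbT => Lt Ut Am.
have [mt|tm] := leP ((sup L + inf U) / 2) t.
  have Lm : L ((sup L + inf U) / 2) by split => //=; rewrite in_itv.
  have := ub_le_sup (proj2 supL) Lm => h.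
  suff -> : t = sup L by [].
  by lra.
have Um : U ((sup L + inf U) / 2) by split => //=; rewrite in_itv/= ltW.
have := ge_inf (proj2 infU) Um => h.
suff -> : t = sup L by [].
by lra.
Qed.

Lemma convex_setP (R : realType) n (A : set 'cV[R]_n) :
  @convex_set R 'cV[R]_n A <->
  forall x y t, 0 <= t <= 1 -> A x -> A y -> A (t *: x + (1 - t) *: y).
Proof.
split=> [cA x y t /andP[t0 t1] Ax Ay|cA x y t].
  have := cA x y (Itv01 t0 t1); rewrite !inE => /(_ Ax Ay); exact.
rewrite !inE => Ax Ay; apply: cA => //.
by rewrite ge0 le1.
Qed.

(** On a segment, the parameters whose point lies in A form a closed midpoint-convex set containing
    0 and 1. *)
Lemma closed_midpoint_convex (R : realType) n (A : set 'cV[R]_n) :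
  closed A -> (forall x y, A x -> A y -> A (2^-1 *: (x + y))) ->
  @convex_set R 'cV[R]_n A.
Proof.
move=> cA Amid; apply/convex_setP => x y t t01 Ax Ay.
pose f (s : R) : 'cV[R]_n := s *: x + (1 - s) *: y.
have cf : continuous f.
  apply: continuous_mx => i j.
  rewrite (_ : (fun s => _) = fun s => s * x i j + (1 - s) * y i j).
    move=> s; apply: (@cvgD _ R^o); apply: (@cvgM R) => //; try exact: cvg_cst.
    by apply: (@cvgB _ R^o) => //; exact: cvg_cst.
  by apply/funext => s; rewrite !mxE.
apply: (@closed_midpoint_itv _ (f @^-1` A)) => //.
- by apply: preimage_closed => // s _; exact: cf.
- by rewrite /f /= scale0r add0r subr0 scale1r.
- by rewrite /f /= subrr scale0r addr0 scale1r.
- move=> r s /Amid h /h; rewrite /f /=.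
  rewrite [X in A X -> _](_ : _ = (r + s) / 2 *: x + (1 - (r + s) / 2) *: y)//.
  by apply/colP => i; rewrite !mxE; field.
Qed.

(* Closed sets are countable unions of compact ones, hence so is their sum. *)
Lemma measurable_minkowski_sum (R : realType) n (A B : set 'cV[R]_n) :
  closed A -> closed B -> measurable (minkowski_sum A B : set (borelVec R n)).
Proof.
move=> cA cB; pose K (k : nat) : set 'cV[R]_n := [set x | `|x| <= k%:R].
have cK k : closed (K k).
  rewrite (_ : K k = (fun x : 'cV[R]_n => `|x|) @^-1` [set r : R | r <= k%:R])//.
  by apply: preimage_closed => [x _|]; [exact: norm_continuous|exact: closed_le].
have ubK (x y : 'cV[R]_n) : exists k, K k x /\ K k y.
  exists (Num.truncn (Num.max `|x| `|y|)).+1; rewrite /K /=.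
  by split; apply: ltW; apply: le_lt_trans (truncnS_gt _);
    rewrite le_max lexx ?orbT.
rewrite (_ : minkowski_sum A B =
    \bigcup_k [set z.1 + z.2 | z in (A `&` K k) `*` (B `&` K k)]).
  apply: bigcup_measurable => k _; apply: closed_measurable_borelVec.
  apply: compact_closed; first exact: norm_hausdorff.
  apply: continuous_compact.
    by apply: continuous_subspaceT; exact: add_continuous.
  apply: compact_setX.
    by apply: (@compact_cV _ _ _ k%:R) => [|x []//]; exact: closedI.
  by apply: (@compact_cV _ _ _ k%:R) => [|x []//]; exact: closedI.
apply/seteqP; split=> [_ [x Ax [y By <-]]|_ [k _ [[x y] [/= [Ax _] [By _]] <-]]].
  by have [k [Kx Ky]] := ubK x y; exists k => //; exists (x, y).
by exists x => //; exists y.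
Qed.

(* The case zeta = 1/2 suffices: a closed midpoint-convex set is convex. *)
Definition midpoint_log_concave (R : realType) n
    (mu : set (borelVec R n) -> \bar R) :=
  forall A B C : set 'cV[R]_n, closed A -> closed B ->
    @convex_set R 'cV[R]_n A -> @convex_set R 'cV[R]_n B ->
    measurable (C : set (borelVec R n)) ->
    (forall a b, A a -> B b -> C (2^-1 *: (a + b))) ->
    fine (mu A) * fine (mu B) <= fine (mu C) ^+ 2.

(** At zeta = 1/2 the powers are square roots, and squaring gives the product form. Empty sets are
    treated apart, since [log_concave] speaks of nonempty ones. *)
Lemma log_concave_midpoint (R : realType) n
    (mu : probability (borelVec R n) R) :
  log_concave mu -> midpoint_log_concave mu.
Proof.
move=> lc A B C cA cB cvA cvB mC ABC.
have mA := closed_measurable_borelVec cA.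
have mB := closed_measurable_borelVec cB.
have [->|/set0P A0] := eqVneq A set0; first by rewrite measure0 mul0r sqr_ge0.
have [->|/set0P B0] := eqVneq B set0; first by rewrite measure0 mulr0 sqr_ge0.
have half01 : 0 <= (2^-1 : R) <= 1 by rewrite invr_ge0 ler0n/= invf_le1// ler1n.
pose D := minkowski_sum [set 2^-1 *: a | a in A] [set (1 - 2^-1) *: b | b in B].
have cZ (c : R) (E : set 'cV[R]_n) : c != 0 -> closed E ->
    closed [set c *: a | a in E].
  move=> c0 cE; rewrite (_ : [set _ | _ in _] = (mulmx c^-1%:M) @^-1` E).
    by apply: preimage_closed => // x _; exact: continuous_mulmxl.
  apply/seteqP; split=> [_ [a Ea <-]/=|x /=];
    rewrite mul_scalar_mx ?scalerK// => Ex.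
  by exists (c^-1 *: x) => //; rewrite scalerKV.
have h2 : 1 - 2^-1 = 2^-1 :> R by field.
(* [log_concave] yields its inequality only for a Borel sum; this one is Borel because both scaled
   summands are closed. *)
have mD : measurable (D : set (borelVec R n)).
  apply: measurable_minkowski_sum; apply: cZ => //;
  by rewrite ?h2 invr_neq0// pnatr_eq0.
have := lc A B 2^-1 mA mB cvA cvB A0 B0 half01 mD; rewrite -/D h2.
have DC : D `<=` C.
  by move=> _ [_ [a Aa <-] [_ [b Bb <-] <-]]; rewrite h2 -scalerDr; exact: ABC.
have fin E : measurable E -> (mu E)%E = (fine (mu E))%:E.
  by move=> mE; rewrite fineK// fin_num_measure.
have : (mu D <= mu C)%E by apply: le_measure; rewrite ?inE.
rewrite (fin A)// (fin B)// (fin C)// (fin D)// => DCm.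
rewrite !poweR_EFin -EFinM lee_fin => le1.
have fge0 E : 0 <= fine (mu E) by exact: fine_ge0.
rewrite !powR12_sqrt ?fge0// in le1.
rewrite lee_fin in DCm.
have le2 := le_trans le1 DCm.
rewrite -(sqr_sqrtr (fge0 A)) -(sqr_sqrtr (fge0 B)) -exprMn.
by rewrite ler_pXn2r ?nnegrE ?fge0 ?mulr_ge0 ?sqrtr_ge0.
Qed.

(** * Prekopa-Leindler for a log-concave probability *)

(** For x > 0 the domain is the half-line from -ln x / c, where [- expR (- c * v)] is an
    antiderivative tending to 0. This is the hypothesis of [integral_layer_cake] for exponential
    levels. *)
Lemma integral_expRN_tail (R : realType) (c x : R) : 0 < c -> 0 <= x ->
  (\int[lebesgue_measure]_(v in [set v | (expR (- c * v) <= x)%R])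
     (c * expR (- c * v))%:E = x%:E)%E.
Proof.
move=> c0; rewrite le_eqVlt => /predU1P[<-|x0].
  rewrite (_ : [set v | _] = set0) ?integral_set0//.
  by rewrite -subset0 => v /=; rewrite leNgt expR_gt0.
pose a := - (ln x / c).
have aE : expR (- c * a) = x.
  by rewrite /a mulrN mulNr opprK mulrCA mulfV ?gt_eqF// mulr1 lnK.
rewrite (_ : [set v | _] = `[a, +oo[%classic); last first.
  apply/seteqP; split=> v /=; rewrite in_itv/= andbT -{1}aE ler_expR !mulNr lerN2;
  by rewrite ler_pM2l.
have cexp : continuous (fun v : R => expR (- c * v)).
  move=> z; apply: continuous_comp; last exact: continuous_expR.
  by apply: continuousM => //; exact: cst_continuous.
have dexp (v : R) : is_derive (v : R^o) (1 : R^o)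
    ((fun v => - expR (- c * v)) : R^o -> R^o) (c * expR (- c * v)).
  apply: is_derive_eq; rewrite /GRing.scale/=; ring.
rewrite (@ge0_continuous_FTC2y _ _ (fun v => - expR (- c * v)) _ 0)//.
- by rewrite aE sub0e EFinN oppeK.
- by move=> v _; rewrite mulr_ge0 ?expR_ge0// ltW.
- apply: continuous_subspaceT => v; apply: (@cvgM R); first exact: cvg_cst.
  exact: cexp.
- rewrite -oppr0; apply: cvgN.
  rewrite (_ : (fun v => expR (- c * v)) =
      (fun z => expR (- z)) \o (fun v => c * v)).
    apply: (@cvg_comp _ _ _ _ _ _ (pinfty_nbhs R)); last exact: cvgr_expR.
    exact: gt0_cvgMry.
  by apply/funext => v /=; rewrite mulNr.
- by apply: cvgN; apply/cvg_at_right_filter; exact: cexp.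
- by move=> v _; rewrite derive1E derive_val.
Qed.

Section exponential_layer.
Context d (W : measurableType d) (R : realType) (mu : probability W R).
Variables (f : W -> R) (c : R).
Hypotheses (mf : measurable_fun setT f) (f0 : forall w, 0 <= f w) (c0 : 0 < c).

(** The layer-cake integrand after the substitution s = e^(-cv), with its Jacobian. Geometric means
    of levels become sums of exponents: f and g will take c = 1, and h will take c = 1/2. *)
Definition exp_layer (v : R) : R :=
  c * expR (- c * v) * fine (mu [set w | expR (- c * v) <= f w]).

Let mexp : measurable_fun setT
  ((fun v => expR (- c * v)) : measurableTypeR R -> measurableTypeR R).
Proof. by apply: measurableT_comp => //; exact: measurable_funM. Qed.

Lemma exp_layer_ge0 v : 0 <= exp_layer v.
Proof. by rewrite !mulr_ge0 ?fine_ge0 ?expR_ge0// ltW. Qed.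

Lemma measurable_exp_layer : measurable_fun setT exp_layer.
Proof.
apply: measurable_funM; first exact: measurable_funM.
apply: (@measurableT_comp _ _ _ _ _ _ (@fine R)) => //.
exact: (measurable_superlevel_measure mu mf mexp).
Qed.

Lemma integral_exp_layer :
  (\int[lebesgue_measure]_v (exp_layer v)%:E = \int[mu]_w (f w)%:E)%E.
Proof.
rewrite (@integral_layer_cake _ _ _ mu f (fun v => expR (- c * v))
  (fun v => c * expR (- c * v)) mf mexp).
- apply: eq_integral => v _; rewrite EFinM fineK// fin_num_measure//.
  exact: measurable_superlevel.
- exact: measurable_funM.
- by move=> v; rewrite mulr_ge0 ?expR_ge0// ltW.
- by move=> w; exact: integral_expRN_tail.
Qed.

End exponential_layer.

(** The cut at v = 0 comes from f <= 1, the decay from mu being a probability. They give the range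
    [0, 1] and the bounded level sets that [prekopa_leindler1] asks for. *)
Lemma exp_layer1_bounds d (W : measurableType d) (R : realType)
    (mu : probability W R) (f : W -> R) (v : R) :
  measurable_fun setT f -> (forall w, 0 <= f w <= 1) ->
  exp_layer mu f 1 v <= expR (- v) /\ (v < 0 -> exp_layer mu f 1 v = 0).
Proof.
move=> mf f01; rewrite /exp_layer mul1r mulN1r; split=> [|v0].
  rewrite -[leRHS]mulr1 ler_wpM2l ?expR_ge0//.
  have mS : measurable [set w | expR (- v) <= f w].
    exact: measurable_superlevel.
  rewrite -lee_fin fineK ?fin_num_measure//; exact: probability_le1.
rewrite (_ : [set w | _] = set0) ?measure0 ?mulr0//.
rewrite -subset0 => w /=; rewrite leNgt => /negP; apply.
have /andP[_ fw1] := f01 w; apply: le_lt_trans fw1 _.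
by rewrite expR_gt1 oppr_gt0.
Qed.

(* With F v = e^(-v) mu {e^(-v) <= f}, whose integral is that of f, the
   multiplicative relation between the level sets of f, g and h becomes the
   hypothesis of the one-dimensional inequality. *)
Lemma prekopa_leindler_midpoint (R : realType) n
    (mu : probability (borelVec R n) R) (f g h : borelVec R n -> R) (a b c : R) :
  midpoint_log_concave mu ->
  measurable_fun setT f -> measurable_fun setT g -> measurable_fun setT h ->
  (forall w, 0 <= f w <= 1) -> (forall w, 0 <= g w <= 1) ->
  (forall w, 0 <= h w) ->
  (forall s, 0 < s -> closed ([set w | s <= f w] : set 'cV[R]_n) /\
    @convex_set R 'cV[R]_n [set w | s <= f w]) ->
  (forall s, 0 < s -> closed ([set w | s <= g w] : set 'cV[R]_n) /\
    @convex_set R 'cV[R]_n [set w | s <= g w]) ->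
  (forall w w' : 'cV[R]_n, f w * g w' <= h (2^-1 *: (w + w')) ^+ 2) ->
  (\int[mu]_w (f w)%:E = a%:E)%E -> (\int[mu]_w (g w)%:E = b%:E)%E ->
  (\int[mu]_w (h w)%:E = c%:E)%E ->
  a * b <= c ^+ 2.
Proof.
move=> mlc mf mg mh f01 g01 h0 fS gS fgh fa gb hc.
have f0 w : 0 <= f w by case/andP: (f01 w).
have g0 w : 0 <= g w by case/andP: (g01 w).
have half0 : 0 < 2^-1 :> R by rewrite invr_gt0.
have lay01 (phi : borelVec R n -> R) : measurable_fun setT phi ->
    (forall w, 0 <= phi w <= 1) -> forall u, 0 <= exp_layer mu phi 1 u <= 1.
  move=> mphi phi01 u; have phi0 w : 0 <= phi w by case/andP: (phi01 w).
  rewrite exp_layer_ge0//=; have [le1 eq0] := exp_layer1_bounds mu u mphi phi01.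
  have [/eq0->//|u0] := ltP u 0.
  by apply: le_trans le1 _; rewrite expR_le1 oppr_le0.
have laybd (phi : borelVec R n -> R) : measurable_fun setT phi ->
    (forall w, 0 <= phi w <= 1) -> forall r : R, 0 < r ->
    exists k : R, forall u, r <= exp_layer mu phi 1 u -> `|u| <= k.
  move=> mphi phi01 r r0; exists (- ln r) => u ru.
  have [le1 eq0] := exp_layer1_bounds mu u mphi phi01.
  have u0 : 0 <= u.
    by rewrite leNgt; apply/negP => /eq0 E; move: ru; rewrite E leNgt r0.
  rewrite ger0_norm// lerNr -ler_expR lnK//; exact: le_trans ru le1.
(* The layer of h at c = 1/2 carries a factor 1/2. Doubling removes it from the pointwise inequality
   and turns the integral into 2c, which matches the 4. *)
suff : 4 * (a * b) <= (2 * c) ^+ 2 by rewrite exprMn -natrX ler_pM2l.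
apply: (@prekopa_leindler1 R (exp_layer mu f 1) (exp_layer mu g 1)
  (fun v => 2 * exp_layer mu h 2^-1 v)).
- exact: measurable_exp_layer.
- exact: measurable_exp_layer.
- by apply: measurable_funM => //; exact: measurable_exp_layer.
- exact: lay01.
- exact: lay01.
- by move=> u; rewrite mulr_ge0// exp_layer_ge0.
- exact: laybd.
- exact: laybd.
- move=> u v; rewrite /exp_layer !mul1r !mulN1r.
  rewrite -[2^-1 * _ * _]mulrA mulVKf// exprMn.
  (* The level of h at u + v is the geometric mean of the levels of f at u and of g at v, so
     midpoints of their level sets fall into that of h. *)
  have eh : expR (- 2^-1 * (u + v)) ^+ 2 = expR (- u) * expR (- v).
    by rewrite expr2 -!expRD; congr expR; field.
  rewrite eh mulrACA ler_wpM2l ?mulr_ge0 ?expR_ge0//.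
  have [cA vA] := fS _ (expR_gt0 (- u)).
  have [cB vB] := gS _ (expR_gt0 (- v)).
  apply: mlc => //.
    exact: measurable_superlevel.
  move=> x y /= fx gy; rewrite -(@ler_pXn2r _ 2)// ?nnegrE ?expR_ge0 ?h0//.
  by rewrite eh; apply: le_trans (fgh x y); rewrite ler_pM ?expR_ge0.
- by rewrite integral_exp_layer.
- by rewrite integral_exp_layer.
- under eq_integral do rewrite EFinM.
  rewrite ge0_integralZl//.
  + by rewrite integral_exp_layer// hc.
  + by apply/measurable_EFinP; exact: measurable_exp_layer.
  + by move=> v _; rewrite lee_fin exp_layer_ge0.
Qed.

(** * Superlevel sets of probabilities *)

(** Each tail union contains some [F j], and the tail unions decrease to the limsup; a finite
    measure is continuous from above. *)
Lemma measure_lim_sup_ge d (T : measurableType d) (R : realType)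
    (P : probability T R) (F : nat -> set T) (b : \bar R) :
  (forall j, measurable (F j)) -> (forall j, b <= P (F j))%E ->
  (b <= P (lim_sup_set F))%E.
Proof.
move=> mF bF.
have mU k : measurable (\bigcup_(j >= k) F j) by exact: bigcup_measurable.
have /(lim_sup_set_cvg P F mF) cvgF : (P (\bigcup_(k >= 0) F k) < +oo)%E.
  by rewrite ltey_eq fin_num_measure.
rewrite -(cvg_lim _ cvgF)//; apply: lime_ge;
  first by apply/cvg_ex; eexists; exact: cvgF.
apply: nearW => k; apply: le_trans (bF k) _; apply: le_measure; rewrite ?inE//.
by move=> t Ft; exists k => /=.
Qed.

(** Take u_j in the superlevel set converging to v. An outcome lying in infinitely many [E (u j)]
    lies in [E v] by closedness, so [E v] contains the limsup of these events. *)
Lemma closed_superlevel_measure d (T : measurableType d) (R : realType)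
    (P : probability T R) (V : normedModType R) (E : V -> set T) (b : \bar R) :
  (forall v, measurable (E v)) -> (forall t, closed [set v | E v t]) ->
  closed [set v | b <= P (E v)]%E.
Proof.
move=> mE cE v clv.
have /choice[u uP] (j : nat) :
    exists u, (b <= P (E u))%E /\ ball v j.+1%:R^-1 u.
  have j0 : 0 < j.+1%:R^-1 :> R by rewrite invr_gt0.
  have [u [Su vu]] := clv _ (nbhsx_ballx v _ j0).
  by exists u.
apply: (le_trans
  (measure_lim_sup_ge (fun j => mE (u j)) (fun j => proj1 (uP j)))).
apply: le_measure; rewrite ?inE; [|exact: mE|].
  apply: bigcap_measurable => // k _; exact: bigcup_measurable.
move=> t lt; apply: (cE t) => U /nbhs_ballP[e /= e0 eU].
have [k _ /(_ k (leqnn k))/= ke] := near_infty_natSinv_lt (PosNum e0).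
have [j /= kj Ejt] := lt k I.
exists (u j); split=> //; apply: eU; apply: le_ball (proj2 (uP j)).
apply: le_trans (ltW ke); rewrite lef_pV2 ?posrE// ler_nat; exact: kj.
Qed.

(** Otherwise there are u_j in the superlevel set with norm above j. No outcome lies in infinitely
    many [E (u j)], yet their limsup has probability at least b > 0. *)
Lemma bounded_superlevel_measure d (T : measurableType d) (R : realType)
    (P : probability T R) (V : normedModType R) (E : V -> set T) (b : R) :
  0 < b -> (forall v, measurable (E v)) ->
  (forall t, exists k : R, forall v, E v t -> `|v| <= k) ->
  exists k : R, forall v, (b%:E <= P (E v))%E -> `|v| <= k.
Proof.
move=> b0 mE Ek; apply: contrapT => /forallNP unb.
have /choice[u uP] (j : nat) : exists u, (b%:E <= P (E u))%E /\ j%:R < `|u|.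
  by have /existsNP[u /not_implyP[bu /negP]] := unb j%:R; rewrite -ltNge; exists u.
have := measure_lim_sup_ge (fun j => mE (u j)) (fun j => proj1 (uP j)).
rewrite (_ : lim_sup_set _ = set0) ?measure0 ?lee_fin ?leNgt ?b0//.
rewrite -subset0 => t lt; have [k Et] := Ek t.
have [j /= kj /Et] := lt (Num.truncn k).+1 I.
have [_ ju] := uP j; move=> /(lt_le_trans ju); apply/negP; rewrite -leNgt.
apply: ltW; apply: (lt_le_trans (truncnS_gt k)); rewrite ler_nat; exact: kj.
Qed.

Lemma prod_measure_eq d1 d2 (T1 : measurableType d1) (T2 : measurableType d2)
    (R : realType) (m1 m2 : {measure set (T1 * T2) -> \bar R}) :
  (m1 setT < +oo)%E ->
  (forall A B, measurable A -> measurable B -> m1 (A `*` B) = m2 (A `*` B)) ->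
  forall X, measurable X -> m1 X = m2 X.
Proof.
move=> m1oo m12 X mX.
pose G : set (set (T1 * T2)) := [set A `*` B | A in measurable & B in measurable].
apply: (measure_unique G (fun=> setT)) => //.
- by rewrite measurable_prod_measurableType.
- move=> _ _ [A mA [B mB <-]] [A' mA' [B' mB' <-]]; rewrite -setXI.
  exists (A `&` A'); first exact: measurableI.
  by exists (B `&` B') => //; exact: measurableI.
- by move=> _; exists setT => //; exists setT => //; rewrite setXTT.
- by rewrite bigcup_const.
- by move=> _ [A mA [B mB <-]]; exact: m12.
Qed.

(** * Law of the state along a mode path *)

Section measurable_vectors.
Context d (U : measurableType d) (R : realType).

Lemma measurable_mulmxl m n (M : 'M[R]_(m, n)) (f : U -> borelVec R n) :
  measurable_fun setT f ->
  measurable_fun setT (fun x => M *m f x : borelVec R m).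
Proof.
move=> mf; apply: measurable_fun_borelVec => i.
under eq_fun do rewrite mxE.
apply: measurable_sum => j; apply: measurable_funM => //.
exact: (measurableT_comp (measurable_coord j) mf).
Qed.

Lemma measurable_vecD n (f g : U -> borelVec R n) :
  measurable_fun setT f -> measurable_fun setT g ->
  measurable_fun setT (fun x => (f x : 'cV[R]_n) + g x : borelVec R n).
Proof.
move=> mf mg; apply: measurable_fun_borelVec => i.
under eq_fun do rewrite mxE.
by apply: measurable_funD; exact: (measurableT_comp (measurable_coord i)).
Qed.

Lemma measurable_state_traj n m p l (S : dmsp R n m p l) (lam : nat -> params S)
    (w : nat -> U -> borelVec R p) t :
  (forall s, (s < t)%N -> measurable_fun setT (w s)) ->
  measurable_fun setT (fun om => state_traj lam (w ^~ om) t : borelVec R n).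
Proof.
elim: t => [|t IHt] mw /=; first exact: measurable_cst.
apply: measurable_vecD; last by apply: measurable_mulmxl; exact: mw.
apply: measurable_vecD; last exact: measurable_cst.
by apply: measurable_mulmxl; apply: IHt => s st; apply: mw; exact: ltnW.
Qed.

End measurable_vectors.

Section state_law.
Variables (R : realType) (n m p l N : nat) (S : dmsp R n m p l).
Context d (T : measurableType d) (P : probability T R).
Variables (w : nat -> {RV P >-> borelVec R p}) (lam : nat -> params S).
Hypothesis w_indep : mutually_independent P N w.

Local Notation X := (fun k om => state_traj lam (w ^~ om) k : borelVec R n).

Let mX k : measurable_fun setT (X k).
Proof. exact: measurable_state_traj. Qed.

Let mpre k (B : set (borelVec R n)) : measurable B -> measurable (X k @^-1` B).
Proof. by move=> mB; rewrite -[Y in measurable Y]setTI; exact: mX. Qed.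

Let mwpre k (B : set (borelVec R p)) : measurable B -> measurable (w k @^-1` B).
Proof.
by move=> mB; rewrite -[Y in measurable Y]setTI; exact: measurable_funP.
Qed.

Let future k (E : 'I_N -> set (borelVec R p)) :=
  [set om | forall i : 'I_N, (k <= i)%N -> E i (w i om)].

Let mfuture k E : (forall i, measurable (E i)) -> measurable (future k E).
Proof.
move=> mE; rewrite (_ : future k E = \bigcap_(i in [set i : 'I_N | (k <= i)%N])
  (w i @^-1` E i)).
  by apply: fin_bigcap_measurable => // i _; exact: mwpre.
by apply/seteqP; split=> om /= h i /h.
Qed.

Let mjoint k : measurable_fun setT (fun om => (w k om, X k om)).
Proof. by apply/measurable_fun_prod. Qed.

(* A statement about all future disturbances at once, so that the step from
   rectangles to Borel sets of pairs (w k, X k) can be iterated. *)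
Lemma state_independent_future k (E : 'I_N -> set (borelVec R p))
    (B : set (borelVec R n)) :
  (k <= N)%N -> (forall i, measurable (E i)) -> measurable B ->
  P (X k @^-1` B `&` future k E) =
  (P (X k @^-1` B) * \prod_(i < N | (k <= i)%N) P (w i @^-1` E i))%E.
Proof.
elim: k E B => [|k IHk] E B kN mE mB.
  rewrite (_ : future 0 E = [set om | forall i : 'I_N, E i (w i om)]); last first.
    by apply/seteqP; split=> om /= h i => [|_]; exact: h.
  have [Bx|Bx] := pselect (B (state0 S)).
    rewrite (_ : _ @^-1` _ = setT); last by apply/seteqP; split=> om.
    by rewrite setTI probability_setT mul1e (w_indep mE).
  rewrite (_ : _ @^-1` _ = set0); last by apply/seteqP; split=> om.
  by rewrite set0I measure0 mul0e.
(* With the disturbances after time k confined to D, both sides become finite measures of the event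
   Y of the pair (w k, X k), and rectangles suffice to compare them. *)
pose D := future k.+1 E; have mD : measurable D by exact: mfuture.
pose pi := (\prod_(i < N | (k < i)%N) P (w i @^-1` E i))%E.
have pi_fin : pi \is a fin_num.
  by apply: prode_fin_num => i _; rewrite fin_num_measure//; exact: mwpre.
have pi_ge0 : 0 <= fine pi by apply: fine_ge0; apply: prode_ge0.
pose J : {mfun T >-> (borelVec R p * borelVec R n)%type} :=
  HB.pack (fun om => (w k om, X k om))
    (isMeasurableFun.Build _ _ _ _ _ (mjoint k)).
pose m2 : {measure set (borelVec R p * borelVec R n) -> \bar R} :=
  mscale (NngNum pi_ge0) (distribution P J).
pose Y := [set z : borelVec R p * borelVec R n |
  B (matA (lam k) *m z.2 + matB (lam k) *m input S k + matF (lam k) *m z.1)].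
have mY : measurable Y.
  rewrite -[Z in measurable Z]setTI /Y.
  pose g (z : borelVec R p * borelVec R n) : borelVec R n :=
    matA (lam k) *m z.2 + matB (lam k) *m input S k + matF (lam k) *m z.1.
  suff mg : measurable_fun setT g by exact: mg.
  apply: measurable_vecD; last by apply: measurable_mulmxl.
  apply: measurable_vecD; last exact: measurable_cst.
  exact: measurable_mulmxl.
pose ko := Ordinal kN.
have rect (A : set (borelVec R p)) (C : set (borelVec R n))
    (E' : 'I_N -> set (borelVec R p)) :
    measurable A -> measurable C -> (forall i, measurable (E' i)) ->
    P (J @^-1` (A `*` C) `&` future k.+1 E') =
    (P (w k @^-1` A) * P (X k @^-1` C) *
     \prod_(i < N | (k < i)%N) P (w i @^-1` E' i))%E.
  move=> mA mC mE'.
  (* Since [future k] includes [w k], the constraint A enters the induction hypothesis at index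
     k. *)
  pose E2 i := if i == ko then A else E' i.
  have mE2 i : measurable (E2 i) by rewrite /E2; case: ifP.
  have := IHk E2 C (ltnW kN) mE2 mC.
  rewrite (bigD1 ko)//= [E2 ko]/E2 eqxx.
  rewrite (_ : _ `&` _ = J @^-1` (A `*` C) `&` future k.+1 E').
    move=> ->; rewrite muleCA muleA; congr (_ * _)%E.
    apply: eq_big => [i|i /andP[_ /negbTE iko]]; last by rewrite /E2 iko.
    by rewrite ltn_neqAle eq_sym andbC.
  apply/seteqP; split=> om /=.
    move=> [CX h]; split.
      by split=> //; have := h ko (leqnn _); rewrite /E2 eqxx.
    move=> i ki; have := h i (ltnW ki); rewrite /E2.
    by case: eqP ki => // ->; rewrite ltnn.
  move=> [[Aw CX] h]; split=> // i; rewrite leq_eqVlt => /predU1P[ki|ki].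
    by rewrite /E2 (_ : i = ko) ?eqxx//; exact/val_inj.
  by rewrite /E2; case: eqP => [ik|_]; [move: ki; rewrite ik ltnn|exact: h].
have rectT (A : set (borelVec R p)) (C : set (borelVec R n)) :
    measurable A -> measurable C ->
    P (J @^-1` (A `*` C)) = (P (w k @^-1` A) * P (X k @^-1` C))%E.
  move=> mA mC; have := rect A C (fun=> setT) mA mC (fun=> measurableT).
  rewrite (_ : future _ _ = setT) ?setIT; last by apply/seteqP; split.
  by rewrite big1 ?mule1// => i _; rewrite preimage_setT probability_setT.
have m12 : pushforward (mrestr P mD) J Y = m2 Y.
  apply: (@prod_measure_eq _ _ _ _ R (pushforward (mrestr P mD) J) m2) => //.
    rewrite -[X in (X < _)%E]/(P ((J @^-1` setT) `&` D)).
    by rewrite preimage_setT setTI ltey_eq fin_num_measure.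
  move=> A C mA mC; rewrite -[LHS]/(P (J @^-1` (A `*` C) `&` D)).
  rewrite -[RHS]/((fine pi)%:E * P (J @^-1` (A `*` C)))%E.
  by rewrite (rect _ _ _ mA mC mE) rectT// fineK// muleC.
rewrite -[LHS]/(pushforward (mrestr P mD) J Y) m12.
by rewrite -[LHS]/((fine pi)%:E * P (J @^-1` Y))%E fineK// muleC.
Qed.

(** A constraint at index k alone in [state_independent_future] shows [w k] and [X k] independent;
    their joint law is then a product, evaluated on Y by sections. *)
Lemma state_noise_joint_law k (Y : set (borelVec R p * borelVec R n)) :
  (k < N)%N -> measurable Y ->
  P [set om | Y (w k om, X k om)] =
  (\int[distribution P (w k)]_v P [set om | Y (v, X k om)])%E.
Proof.
move=> kN mY.
pose J : {mfun T >-> (borelVec R p * borelVec R n)%type} :=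
  HB.pack (fun om => (w k om, X k om))
    (isMeasurableFun.Build _ _ _ _ _ (mjoint k)).
pose Xk : {mfun T >-> borelVec R n} :=
  HB.pack (X k) (isMeasurableFun.Build _ _ _ _ _ (mX k)).
transitivity ((distribution P (w k) \x distribution P Xk)%E Y); last first.
  rewrite /product_measure1; apply: eq_integral => v _ /=.
  rewrite /distribution /pushforward; congr (P _).
  by apply/seteqP; split=> om /=; rewrite /xsection/= inE.
apply/esym.
apply: (@product_measure_unique _ _ _ _ R _ _ (distribution P J)) => //.
move=> A C mA mC.
pose E (i : 'I_N) := if i == Ordinal kN then A else setT.
have mE i : measurable (E i) by rewrite /E; case: ifP.
have := state_independent_future (ltnW kN) mE mC.
rewrite (bigD1 (Ordinal kN))//= [E (Ordinal kN)]/E eqxx big1 ?mule1; last first.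
  by move=> i /andP[_ /negbTE ik]; rewrite /E ik preimage_setT probability_setT.
rewrite muleC => <-; rewrite /distribution /pushforward; congr (P _).
apply/seteqP; split=> om /=.
  move=> [Aw CX]; split=> // i _; rewrite /E.
  by case: eqP => // ->.
by move=> [CX h]; split=> //; have := h (Ordinal kN) (leqnn _); rewrite /E eqxx.
Qed.

End state_law.

Section state_log_concave.
Variables (R : realType) (n m p l N : nat) (S : dmsp R n m p l).
Context d (T : measurableType d) (P : probability T R).
Variables (w : nat -> {RV P >-> borelVec R p}) (lam : nat -> params S).
Variable Pw : probability (borelVec R p) R.
Hypothesis w_law : forall t, (t < N)%N -> forall E : set (borelVec R p),
  measurable E -> distribution P (w t) E = Pw E.
Hypothesis w_indep : mutually_independent P N w.
Hypothesis Pw_mlc : midpoint_log_concave Pw.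

Local Notation X := (fun k om => state_traj lam (w ^~ om) k : borelVec R n).

(** Induction on time. For a frozen noise v, the probability [f D v] that the next state is in D
    inherits a midpoint inequality from the law of [X k], and Prekopa-Leindler integrates it over v.
    At time 0 the law is a point mass. *)
Lemma state_midpoint_log_concave k : (k <= N)%N ->
  midpoint_log_concave (fun B => P [set om | B (X k om)]).
Proof.
elim: k => [|k IHk] kN A B C cA cB vA vB mC ABC.
  have cst (D : set 'cV[R]_n) : ~ D (state0 S) ->
      fine (P [set om | D (X 0%N om)]) = 0.
    by move=> Dx; rewrite (_ : [set om | _] = set0) ?measure0//; rewrite -subset0.
  have [Ax|/cst ->] := pselect (A (state0 S)); last by rewrite mul0r sqr_ge0.
  have [Bx|/cst ->] := pselect (B (state0 S)); last by rewrite mulr0 sqr_ge0.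
  have full (D : set 'cV[R]_n) : D (state0 S) ->
      fine (P [set om | D (X 0%N om)]) = 1.
    move=> Dx; rewrite (_ : [set om | _] = setT) ?probability_setT//.
    by apply/seteqP; split.
  have Cx : C (state0 S).
    suff -> : state0 S = 2^-1 *: (state0 S + state0 S) by exact: ABC.
    by apply/colP => i; rewrite !mxE; field.
  by rewrite !full// mulr1 expr1n.
pose g (v : 'cV[R]_p) (x : 'cV[R]_n) : 'cV[R]_n :=
  matA (lam k) *m x + matB (lam k) *m input S k + matF (lam k) *m v.
have mg : measurable_fun setT
    (fun z : borelVec R p * borelVec R n => g z.1 z.2 : borelVec R n).
  apply: measurable_vecD; last exact: measurable_mulmxl.
  apply: measurable_vecD; last exact: measurable_cst.
  exact: measurable_mulmxl.
have gmid v v' x x' :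
    g (2^-1 *: (v + v')) (2^-1 *: (x + x')) = 2^-1 *: (g v x + g v' x').
  by rewrite /g -!scalemxAr !mulmxDr; apply/colP => i; rewrite !mxE; field.
have gconv v x y t :
    g v (t *: x + (1 - t) *: y) = t *: g v x + (1 - t) *: g v y.
  by rewrite /g !mulmxDr -!scalemxAr; apply/colP => i; rewrite !mxE; ring.
have gcx v : continuous (g v).
  rewrite (_ : g v = fun x => matA (lam k) *m x +
      (matB (lam k) *m input S k + matF (lam k) *m v)).
    exact: continuous_affine.
  by apply/funext => x; rewrite /g addrA.
have gcv x : continuous (g ^~ x).
  rewrite (_ : g ^~ x = fun v => matF (lam k) *m v +
      (matA (lam k) *m x + matB (lam k) *m input S k)).
    exact: continuous_affine.
  by apply/funext => v; rewrite /g addrC.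
pose E (D : set 'cV[R]_n) (v : 'cV[R]_p) : set T := [set om | D (g v (X k om))].
pose Y (D : set (borelVec R n)) :=
  [set z : borelVec R p * borelVec R n | D (g z.1 z.2)].
have mY D : measurable D -> measurable (Y D).
  by move=> mD; rewrite -[Z in measurable Z]setTI; exact: mg.
have mX : measurable_fun setT (X k) by exact: measurable_state_traj.
pose Xk : {mfun T >-> borelVec R n} :=
  HB.pack (X k) (isMeasurableFun.Build _ _ _ _ _ mX).
have ED D v : P (E D v) = distribution P Xk (xsection (Y D) v).
  rewrite /distribution /pushforward; congr (P _).
  by apply/seteqP; split=> om /=; rewrite /xsection/= inE.
have mE (D : set (borelVec R n)) v : measurable D -> measurable (E D v).
  move=> mD; rewrite (_ : E D v = X k @^-1` xsection (Y D) v).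
    rewrite -[Z in measurable Z]setTI; apply: (mX measurableT).
    by apply: measurable_xsection; exact: mY.
  by apply/seteqP; split=> om /=; rewrite /xsection/= inE.
pose f D v := fine (P (E D v)).
have fE (D : set (borelVec R n)) v : measurable D -> (f D v)%:E = P (E D v).
  by move=> mD; rewrite /f fineK// fin_num_measure//; exact: mE.
have f01 (D : set (borelVec R n)) v : measurable D -> 0 <= f D v <= 1.
  by move=> mD; rewrite -!lee_fin fE// measure_ge0 probability_le1//; exact: mE.
have mf (D : set (borelVec R n)) :
    measurable D -> measurable_fun setT (f D : borelVec R p -> R).
  move=> mD; apply: (@measurableT_comp _ _ _ _ _ _ (@fine R)) => //.
  apply: (eq_measurable_fun (fun v => distribution P Xk (xsection (Y D) v))).
    by move=> v _; rewrite ED.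
  by apply: measurable_fun_xsection; exact: mY.
have int_f (D : set (borelVec R n)) : measurable D ->
    (\int[Pw]_v (f D v)%:E = (fine (P [set om | D (X k.+1 om)]))%:E)%E.
  move=> mD; rewrite fineK; last first.
    apply: fin_num_measure; rewrite -[Z in measurable Z]setTI.
    by apply: (@measurable_state_traj _ _ _ _ _ _ _ S lam w k.+1).
  rewrite (_ : P _ = P [set om | Y D (w k om, X k om)])//.
  rewrite (state_noise_joint_law lam w_indep)//; last exact: mY.
  under eq_integral do rewrite fE//.
  by apply: eq_measure_integral => G mG _; apply/esym/w_law.
(* This is the induction hypothesis for the preimages of D1, D2 and D3 under the affine step with
   noise v, v' and their midpoint. *)
have f_mid (D1 D2 D3 : set 'cV[R]_n) v v' : closed D1 -> closed D2 ->
    @convex_set R 'cV[R]_n D1 -> @convex_set R 'cV[R]_n D2 ->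
    measurable (D3 : set (borelVec R n)) ->
    (forall a b, D1 a -> D2 b -> D3 (2^-1 *: (a + b))) ->
    f D1 v * f D2 v' <= f D3 (2^-1 *: (v + v')) ^+ 2.
  move=> c1 c2 v1 v2 m3 D123.
  have cl (D : set 'cV[R]_n) u : closed D -> closed [set x | D (g u x)].
    by move=> cD; apply: (@preimage_closed _ _ (g u)) => // x _; exact: gcx.
  have cv (D : set 'cV[R]_n) u : @convex_set R 'cV[R]_n D ->
      @convex_set R 'cV[R]_n [set x | D (g u x)].
    move=> /convex_setP vD; apply/convex_setP => x y t t01 Dx Dy /=.
    by rewrite gconv; exact: vD.
  apply: (IHk (ltnW kN) [set x | D1 (g v x)] [set x | D2 (g v' x)]
    [set x | D3 (g (2^-1 *: (v + v')) x)]); [exact: cl..|exact: cv|exact: cv| |].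
    rewrite (_ : [set x | _] = xsection (Y D3) (2^-1 *: (v + v'))).
      by apply: measurable_xsection; exact: mY.
    by apply/seteqP; split=> x /=; rewrite /xsection/= inE.
  by move=> x y /= Dx Dy; rewrite gmid; exact: D123.
(* Closedness comes from that of D and continuity of the step in the noise; convexity from [f_mid]
   with D in all three places. *)
have f_level (D : set 'cV[R]_n) s :
    closed D -> @convex_set R 'cV[R]_n D -> 0 < s ->
    closed ([set v | s <= f D v] : set 'cV[R]_p) /\
    @convex_set R 'cV[R]_p [set v | s <= f D v].
  move=> cD vD s0; have mD := closed_measurable_borelVec cD.
  have cS : closed ([set v | s <= f D v] : set 'cV[R]_p).
    rewrite (_ : [set v | _] = [set v | (s%:E <= P (E D v))%E]); last first.
      by apply/seteqP; split=> v /=; rewrite -fE// lee_fin.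
    apply: closed_superlevel_measure => [v|om]; first exact: mE.
    apply: (@preimage_closed _ _ (g ^~ (X k om))) => // v _; exact: gcv.
  split=> //; apply: closed_midpoint_convex => // v v' /= sv sv'.
  have h : f D v * f D v' <= f D (2^-1 *: (v + v')) ^+ 2.
    apply: f_mid => // a b Da Db.
    move/convex_setP : vD => /(_ a b 2^-1 _ Da Db).
    rewrite (_ : 2^-1 *: a + (1 - 2^-1) *: b = 2^-1 *: (a + b)).
      by apply; rewrite invr_ge0 ler0n/= invf_le1// ler1n.
    by apply/colP => i; rewrite !mxE; field.
  have /andP[f0 _] := f01 _ (2^-1 *: (v + v')) mD.
  rewrite -(@ler_pXn2r _ 2)// ?nnegrE//; last exact: ltW.
  by apply: le_trans h; rewrite expr2 ler_pM// ltW.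
have mA := closed_measurable_borelVec cA.
have mB := closed_measurable_borelVec cB.
apply: (@prekopa_leindler_midpoint _ _ Pw (f A) (f B) (f C)) => //.
- exact: mf.
- exact: mf.
- exact: mf.
- by move=> v; exact: f01.
- by move=> v; exact: f01.
- by move=> v; case/andP: (f01 C v mC).
- by move=> s; exact: f_level.
- by move=> s; exact: f_level.
- by move=> v v'; exact: f_mid.
- exact: int_f.
- exact: int_f.
- exact: int_f.
Qed.

End state_log_concave.

(** * Occupied sets and covering *)

Lemma param_traj_ext (R : realType) (n m p l : nat) (S : dmsp R n m p l)
    (q q' : nat -> modes S) t :
  (forall i, (0 < i <= t)%N -> q i = q' i) -> param_traj q t = param_traj q' t.
Proof.
elim: t => [//|t IHt] qq' /=; rewrite (qq' t.+1) ?ltnSn// IHt// => i /andP[i0 it].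
by apply: qq'; rewrite i0 leqW.
Qed.

Lemma state_traj_ext (R : realType) (n m p l : nat) (S : dmsp R n m p l)
    (lam lam' : nat -> params S) (w : nat -> 'cV[R]_p) t :
  (forall s, (s < t)%N -> lam s = lam' s) ->
  state_traj lam w t = state_traj lam' w t.
Proof.
elim: t => [//|t IHt] ll' /=; rewrite ll' ?ltnSn// IHt// => s st.
by apply: ll'; exact: ltnW.
Qed.

Lemma opp_obstacleE (R : realType) n (h : 'cV[R]_n -> R) (y z : 'cV[R]_n) :
  opp_set (obstacle h (- y)) z = obstacle h 0 (y - z).
Proof. by rewrite /opp_set /obstacle /= subr0 opprK addrC. Qed.

Lemma measure_bigcup_finType d (T : measurableType d) (R : realType)
    (P : probability T R) (I : finType) (F : I -> set T) :
  (forall i, measurable (F i)) -> (P (\bigcup_i F i) <= \sum_i P (F i))%E.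
Proof.
move=> mF.
rewrite (_ : \bigcup_i F i = \big[setU/set0]_(i <- index_enum I) F i).
  elim: (index_enum I) => [|i s IHs]; first by rewrite !big_nil measure0.
  rewrite !big_cons; apply: le_trans (leeD2l _ IHs).
  by apply: measureU2 => //; exact: bigsetU_measurable.
rewrite -bigcup_seq; apply/seteqP; split=> t [i _ Fit]; exists i => //=.
exact: mem_index_enum.
Qed.

Lemma closed_subl (R : realType) n (E : set 'cV[R]_n) (y : 'cV[R]_n) :
  closed E -> closed [set z : 'cV[R]_n | E (y - z)].
Proof.
move=> cE; apply: (@preimage_closed 'cV[R]_n 'cV[R]_n (fun z => y - z)) => // z _.
rewrite (_ : (fun z => y - z) = fun z => (- 1)%:M *m z + y).
  exact: continuous_affine.
by apply/funext => x; rewrite mul_scalar_mx scaleN1r addrC.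
Qed.

Section occupied_set.
Variables (R : realType) (n : nat).
Context d (T : measurableType d) (P : probability T R).
Variable X : T -> borelVec R n.
Hypothesis mX : measurable_fun setT X.
Hypothesis X_mlc : midpoint_log_concave (fun B => P [set om | B (X om)]).
Variable O : set 'cV[R]_n.
Hypotheses (O_convex : @convex_set R 'cV[R]_n O) (O_compact : compact O).

Let cO : closed O.
Proof. by apply: compact_closed => //; exact: norm_hausdorff. Qed.

Lemma measurable_occupy (y : 'cV[R]_n) : measurable [set om | O (y - X om)].
Proof.
have := mX measurableT (closed_measurable_borelVec (@closed_subl R n _ y cO)).
by rewrite setTI.
Qed.

(** Midpoint log-concavity of the law of X, applied to y - O and y' - O, makes K midpoint-convex.
    For a fixed outcome, y ranges over the bounded set X + O, whence K is bounded. *)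
Lemma occupied_set_compact_convex (b : R) : 0 < b ->
  let K := [set y : 'cV[R]_n | (b%:E <= P [set om | O (y - X om)%R])%E] in
  @convex_set R 'cV[R]_n K /\ compact K.
Proof.
move=> b0 K.
have cK : closed K.
  apply: closed_superlevel_measure => [y|om]; first exact: measurable_occupy.
  apply: (@preimage_closed 'cV[R]_n 'cV[R]_n
    (fun y => y - (X om : 'cV[R]_n))) => // y _.
  rewrite (_ : (fun y => _) = fun y => 1%:M *m y + - (X om : 'cV[R]_n)).
    exact: continuous_affine.
  by apply/funext => z; rewrite mul1mx.
split.
  apply: closed_midpoint_convex => // y y'; rewrite /K /=.
  have fin z : P [set om | O (z - X om)] = (fine (P [set om | O (z - X om)]))%:E.
    by rewrite fineK// fin_num_measure//; exact: measurable_occupy.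
  rewrite (fin y) (fin y') (fin (2^-1 *: (y + y'))) !lee_fin => Py Py'.
  have cv z : @convex_set R 'cV[R]_n [set x | O (z - x)].
    apply/convex_setP => x x' t t01 Ox Ox' /=.
    move/convex_setP : O_convex => /(_ _ _ _ t01 Ox Ox').
    by congr O; apply/colP => i; rewrite !mxE; ring.
  have mid x x' : O (y - x) -> O (y' - x') ->
      O (2^-1 *: (y + y') - 2^-1 *: (x + x')).
    move=> Ox Ox'; move/convex_setP : O_convex => /(_ _ _ 2^-1 _ Ox Ox').
    rewrite invr_ge0 ler0n/= invf_le1// ler1n => /(_ isT).
    by congr O; apply/colP => i; rewrite !mxE; field.
  have h := X_mlc (@closed_subl R n _ y cO) (@closed_subl R n _ y' cO)
    (cv y) (cv y')
    (closed_measurable_borelVec (@closed_subl R n _ (2^-1 *: (y + y')) cO)) mid.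
  rewrite -(@ler_pXn2r _ 2)// ?nnegrE ?fine_ge0//; last exact: ltW.
  by apply: le_trans h; rewrite expr2 ler_pM// ltW.
have [M [Mreal OM]] := compact_bounded O_compact.
have [k Kk] : exists k : R, forall y,
    (b%:E <= P [set om | O (y - X om)%R])%E -> `|y| <= k.
  apply: (@bounded_superlevel_measure _ _ _ P 'cV[R]_n) => // [y|om].
    exact: measurable_occupy.
  (* [compact_bounded] bounds O by any number strictly above M. *)
  exists (M + 1 + `|X om : 'cV[R]_n|) => y /= Oy.
  have OM1 := OM (M + 1) _ _ Oy; rewrite -lerBlDr.
  by apply: le_trans (lerB_dist _ _) (OM1 _); rewrite ltrDl.
exact: compact_cV cK Kk.
Qed.

End occupied_set.

Section mode_paths.
Variables (R : realType) (n m p l N : nat) (S : dmsp R n m p l).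
Context d (T : measurableType d) (P : probability T R).
Variables (sigma : nat -> T -> modes S) (w : nat -> {RV P >-> borelVec R p}).
Variables (h_obs : 'cV[R]_n -> R) (tau : nat).
Hypothesis tau_bounds : (1 <= tau <= N)%N.
Hypothesis m_sigma : forall t q, (t <= N)%N -> measurable (sigma t @^-1` [set q]).

Lemma path_event_bigcap (q : tau.-tuple (modes S)) :
  path_event sigma q =
  \bigcap_(i in [set: 'I_tau]) (sigma i.+1 @^-1` [set tnth q i]).
Proof. by apply/seteqP; split=> om h i => [_|]; exact: h. Qed.

Lemma measurable_path_event (q : tau.-tuple (modes S)) :
  measurable (path_event sigma q).
Proof.
rewrite path_event_bigcap; apply: fin_bigcap_measurable => // i _.
by apply: m_sigma; case/andP: tau_bounds => _; exact: leq_trans.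
Qed.

Lemma path_event_mode_events (q : tau.-tuple (modes S)) :
  mode_events N sigma (path_event sigma q).
Proof.
rewrite path_event_bigcap /mode_events.
set G := (X in <<s X >>).
apply: (@fin_bigcap_measurable _ (g_sigma_algebraType G)) => // i _.
apply: sub_sigma_algebra; exists i.+1, (tnth q i); split=> //.
by case/andP: tau_bounds => _; exact: leq_trans.
Qed.

(** The state at tau involves the parameters up to tau - 1, hence the modes q_1, ..., q_(tau - 1);
    so [take tau.-1] drops the last item of q. *)
Lemma dmsp_state_path (q : tau.-tuple (modes S)) om :
  path_event sigma q om ->
  dmsp_state sigma w tau om = path_state w (take tau.-1 q) tau om.
Proof.
move=> qom; apply: state_traj_ext => s st.
apply: param_traj_ext => -[//|i] /andP[_ is_].
have itau : (i < tau)%N by apply: leq_trans st; exact: ltnW.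
have := qom (Ordinal itau); rewrite /= => ->.
rewrite nth_take; last first.
  by rewrite -ltnS prednK ?(leq_trans _ st)// (leq_ltn_trans is_ st).
by rewrite (tnth_nth (mode0 S)).
Qed.

(** [measurable_state_traj] is applied to T with the sigma-algebra generated by the disturbances,
    for which each [w s] with s < tau is measurable by construction. *)
Lemma path_state_noise_events (qs : seq (modes S)) (B : set (borelVec R n)) :
  measurable B -> noise_events N w (path_state w qs tau @^-1` B).
Proof.
move=> mB; rewrite /noise_events; set G := (X in <<s X >>).
rewrite -[Y in <<s G >> Y]setTI.
apply: (@measurable_state_traj _ (g_sigma_algebraType G) R n m p l S
  (param_traj (nth (mode0 S) (mode0 S :: qs))) w tau) => // s st.
move=> _ E mE; rewrite setTI; apply: sub_sigma_algebra.
exists s, E; split=> //; apply: (leq_trans st); by case/andP: tau_bounds.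
Qed.

End mode_paths.

Theorem theorem6 (R : realType) (n m p l N : nat) (N_ge1 : (1 <= N)%N)
    (S : dmsp R n m p l)
    (d : measure_display) (T : measurableType d) (P : probability T R)
    (sigma : nat -> T -> modes S)
    (sigma_markov : markov_chain P N sigma)
    (sigma_init : forall om, sigma 0%N om = mode0 S)
    (w : nat -> {RV P >-> borelVec R p})
    (Pw : probability (borelVec R p) R)
    (w_law : forall t, (t < N)%N -> forall E : set (borelVec R p),
      measurable E -> distribution P (w t) E = Pw E)
    (w_indep : mutually_independent P N w)
    (w_sigma_indep : independent_processes P N sigma w)
    (Pw_density : has_density Pw)
    (h_obs : 'cV[R]_n -> R)
    (h_obs_borel : measurable_fun [set: borelVec R n] h_obs)
    (O_borel : measurable (obstacle h_obs 0 : set (borelVec R n)))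
    (O_neq0 : lebesgueVec R n (obstacle h_obs 0) != 0%E)
    (Pw_log_concave : log_concave Pw)
    (O_convex : @convex_set R 'cV[R]_n (obstacle h_obs 0))
    (O_compact : compact (obstacle h_obs 0))
    (alpha : R) (alpha_gt0 : 0 < alpha)
    (tau : nat) (tau_bounds : (1 <= tau <= N)%N) :
  PrOccupySetS P sigma w h_obs alpha tau `<=`
    \bigcup_(q in [set` positive_paths P sigma tau])
      PrOccupySetP P w h_obs (alphaS P sigma alpha q) tau (take tau.-1 q)
  /\ forall q, q \in positive_paths P sigma tau ->
      let K := PrOccupySetP P w h_obs (alphaS P sigma alpha q) tau
                 (take tau.-1 q) in
      @convex_set R 'cV[R]_n K /\ compact K.
Proof.
have [sigma_meas _] := sigma_markov.
have Pw_mlc := log_concave_midpoint Pw_log_concave.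
have /andP[tau_gt0 tauN] := tau_bounds.
pose X (qs : seq (modes S)) : T -> borelVec R n := path_state w qs tau.
have mX qs : measurable_fun setT (X qs) by exact: measurable_state_traj.
have X_mlc qs : midpoint_log_concave (fun B => P [set om | B (X qs om)]).
  exact: (state_midpoint_log_concave _ w_law w_indep Pw_mlc tauN).
have hitE (y : 'cV[R]_n) qs :
    [set om | opp_set (obstacle h_obs (- y)) (path_state w qs tau om)] =
    [set om | obstacle h_obs 0 (y - X qs om)].
  by apply/seteqP; split=> om /=; rewrite opp_obstacleE.
split=> [y /= y_occ|q]; last first.
  rewrite inE => q_pos K.
  (* Boundedness of the occupied set needs a positive level; here q itself witnesses that the number
     of positive paths is nonzero. *)
  have b_gt0 : 0 < alphaS P sigma alpha q.
    rewrite divr_gt0// mulr_gt0//.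
      by rewrite ltr0n; apply/card_gt0P; exists q; rewrite inE.
    rewrite fine_gt0// q_pos ltey_eq fin_num_measure//.
    exact: (measurable_path_event tau_bounds).
  have := occupied_set_compact_convex (mX (take tau.-1 q)) (X_mlc _)
    O_convex O_compact b_gt0.
  rewrite /K /PrOccupySetP.
  under [X in _ -> @convex_set _ _ X /\ _]eq_set do rewrite hitE.
  by under [X in _ -> _ /\ compact X]eq_set do rewrite hitE.
pose F (q : tau.-tuple (modes S)) :=
  [set om | obstacle h_obs 0 (y - X (take tau.-1 q) om)].
have mF (q : tau.-tuple (modes S)) : measurable (F q) by exact: measurable_occupy.
have mE (q : tau.-tuple (modes S)) : measurable (path_event sigma q).
  exact: (measurable_path_event tau_bounds).
(* With the parameters frozen along q, [F q] depends on the disturbances only, and the path event on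
   the modes only. *)
have indep (q : tau.-tuple (modes S)) :
    P (path_event sigma q `&` F q) = (P (path_event sigma q) * P (F q))%E.
  apply: w_sigma_indep; first exact: path_event_mode_events.
  have mB : measurable ([set z | obstacle h_obs 0 (y - z)] : set (borelVec R n)).
    apply: closed_measurable_borelVec; apply: closed_subl.
    by apply: compact_closed => //; exact: norm_hausdorff.
  exact: (@path_state_noise_events _ _ _ _ _ _ _ _ _ _ w _ tau_bounds
    (take tau.-1 q) _ mB).
(* The realized modes select a path, along which the true state is the path state; so the hit event
   is the union over q of the path event of q intersected with [F q]. *)
have occ_le : (alpha%:E <=
    \sum_(q : tau.-tuple (modes S)) P (path_event sigma q) * P (F q))%E.
  apply: le_trans y_occ _; under eq_bigr do rewrite -indep.
  apply: le_trans (measure_bigcup_finType P _); last by move=> q; exact: measurableI.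
  rewrite le_eqVlt; apply/orP; left; apply/eqP; congr (P _).
  apply/seteqP; split=> om /=.
    move=> [r _ [_ /= hit]].
    have qom : path_event sigma [tuple sigma i.+1 om | i < tau] om.
      by move=> i; rewrite tnth_mktuple.
    exists [tuple sigma i.+1 om | i < tau] => //; split=> //.
    by rewrite /F /= -opp_obstacleE /X -(dmsp_state_path w qom).
  move=> [q _ [qom Fq]]; exists (sigma tau om) => //; split=> //=.
  by rewrite (dmsp_state_path w qom) opp_obstacleE.
(* Otherwise every term with positive path probability is smaller than its
   equal share of alpha. *)
apply: contrapT => /= ncov.
have small q : q \in positive_paths P sigma tau ->
    fine (P (path_event sigma q)) * fine (P (F q)) <
    alpha / #|positive_paths P sigma tau|%:R.
  move=> qpos; rewrite ltNge; apply/negP => large; apply: ncov; exists q => //=.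
  rewrite /PrOccupySetP /= hitE -[X in (_ <= X)%E]/(P (F q)).
  rewrite -(fineK (fin_num_measure P _ (mF q))) lee_fin.
  have P_gt0 : 0 < fine (P (path_event sigma q)).
    move: qpos; rewrite inE => qpos.
    by rewrite fine_gt0// qpos ltey_eq fin_num_measure.
  by rewrite /alphaS invfM mulrA ler_pdivrMr// [X in _ <= X]mulrC.
(* Paths of probability zero contribute nothing to the sum. *)
move: occ_le; rewrite (bigID (mem (positive_paths P sigma tau)))/=.
rewrite [X in (_ + X)%E]big1 ?adde0; last first.
  move=> q; rewrite inE -leNgt measure_le0 => /eqP ->; exact: mul0e.
under eq_bigr do rewrite -(fineK (fin_num_measure P _ (mE _)))
  -(fineK (fin_num_measure P _ (mF _))) -EFinM.
rewrite sumEFin lee_fin leNgt => /negP; apply.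
(* A strict inequality between sums needs at least one term; with no positive path the sum is 0,
   already below alpha. *)
have [->|[q0 q0pos]] := set_0Vmem (positive_paths P sigma tau).
  by rewrite big_set0.
apply: (@lt_le_trans _ _ (\sum_(q in positive_paths P sigma tau)
    alpha / #|positive_paths P sigma tau|%:R)).
  apply: ltr_sum => //; apply/hasP; exists q0 => //; exact: mem_index_enum.
rewrite sumr_const -[_ *+ _]mulr_natr divfK//.
by rewrite pnatr_eq0 -lt0n; apply/card_gt0P; exists q0.
Qed.
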